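(* Let $d\ge1$, $T>0$, $H\in(\frac13,\frac12]$, $\alpha\in(\frac13,H)$, $x_0\in\mathbb{R}^d$, and let $\mathbf B^H=(B^H,\mathbb B^H)$ be (a realization of) the $\alpha$-geometric rough path lift of a $d$-dimensional fractional Brownian motion. Assume: (F1) $f:\mathbb{R}^d\to\mathbb{R}^d$ is bounded and continuous; (S1) $\sigma:\mathbb{R}^d\to M_{d\times d}(\mathbb{R})$ is twice continuously differentiable with $\|\sigma\|_\infty+\|D\sigma\|_\infty+\|D^2\sigma\|_\infty<\infty$; (S2) there is $\lambda>0$ such that $|v^{\intercal}\sigma(x)v|\ge\lambda\|v\|^2$ for all $v,x\in\mathbb{R}^d$; (S3) $\sigma^{-1}$ is a conservative vector field, i.e. $\int_\gamma\sigma(x)^{-1}dx$ depends only on the end points of the path $\gamma$. Let $(X,\sigma(X))\in C^\alpha_{B^H}(\mathbb{R}^d)$ be a solution on $[0,T]$ of $X_t=x_0+\int_0^tf(X_s)ds+\int_0^t\sigma(X_s)d\mathbf B^H_s$, and let $\mathbf X=(X,\mathbb X)$ be the $\alpha$-geometric rough path over $X$ given by $$\mathbb X_{s,t}=\int_s^t(X_r-X_s)\otimes f(X_r)\,dr+\int_s^t\eta(X_r)\,d\mathbf B^H_r-X_s\otimes\int_s^t\sigma(X_r)\,d\mathbf B^H_r,$$ where $\eta(x)y:=x\otimes(\sigma(x)y)$. If $F:\mathbb{R}^d\to M_{d\times d}(\mathbb{R})$ is a $C^2$ function, then $$\int_0^TF(X_r)\,d\mathbf X_r=\int_0^TF(X_r)f(X_r)\,dr+\int_0^TF(X_r)\sigma(X_r)\,d\mathbf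 B^H_r .$$
   Context: Notation: $W_{s,t}:=W_t-W_s$. An $\alpha$-rough path over an $\alpha$-Hölder path $W:[0,T]\to\mathbb{R}^d$ is a pair $\mathbf W=(W,\mathbb W)$, $\mathbb W:[0,T]^2\to\mathbb{R}^d\otimes\mathbb{R}^d$, with $\mathbb W_{s,t}-\mathbb W_{s,u}-\mathbb W_{u,t}=W_{s,u}\otimes W_{u,t}$, $\sup_{s\ne t}|W_{s,t}|/|t-s|^\alpha<\infty$ and $\sup_{s\neq t}|\mathbb W_{s,t}|/|t-s|^{2\alpha}<\infty$. It is geometric if the symmetric part of $\mathbb W_{s,t}$ equals $\frac12W_{s,t}\otimes W_{s,t}$. A $W$-controlled rough path is a pair of $\alpha$-Hölder paths $(Y,Y')$ on $[0,T]$ with values in $\mathbb{R}^m$ and $\mathbb{R}^{m\times d}$ such that $\sup_{s\neq t}|Y_{s,t}-Y'_sW_{s,t}|/|t-s|^{2\alpha}<\infty$; the space of these is $C^\alpha_W(\mathbb{R}^m)$. For a controlled rough path with values in $(\mathbb{R}^{m\times d},\mathbb{R}^{m\times d\times d})$ the rough integral is $\int_s^tY_r\,d\mathbf W_r:=\lim_{|\mathcal P|\to0}\sum_{[u,v]\in\mathcal P}(Y_uW_{u,v}+Y'_u\mathbb W_{u,v})$ over partitions $\mathcal P$ of $[s,t]$, where $(Y'_u\mathbb W_{u,v})^i=\sum_{a,k}(Y'_u)^{i,k}_a\mathbb W^{a,k}_{u,v}$, $a$ being the index of the Gubinelli-derivative direction and $k$ the integrator index. Solution: a fixed point $(X,X')\in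 C^\alpha_{B^H}(\mathbb{R}^d)$ of $\Psi(Y,Y')(t)=\big(x_0+\int_0^tf(Y_r)dr+\int_0^t\sigma(Y_r)d\mathbf B^H_r,\ \sigma(Y_t)\big)$, where the second integral is the rough integral of $(\sigma(Y),D\sigma(Y)Y')$; in particular $X'=\sigma(X)$. Integrals appearing: for a $C^1$ (matrix-valued) function $\Phi$, $\int\Phi(X_r)d\mathbf B^H_r$ is the rough integral of the $B^H$-controlled rough path $(\Phi(X),D\Phi(X)\sigma(X))$ (applied to $\Phi=\sigma$, $\eta$, and $F\sigma:x\mapsto F(x)\sigma(x)$), and $\int_0^TF(X_r)d\mathbf X_r$ is the rough integral of the $X$-controlled rough path $(F(X),DF(X))$ against $\mathbf X$. *)

(* Defs.v *)
From HB Require Import structures.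
From mathcomp Require Import all_boot all_order all_algebra.
From mathcomp Require Import all_classical all_reals all_analysis.

Set Implicit Arguments.
Unset Strict Implicit.
Unset Printing Implicit Defensive.

Import Order.TTheory GRing.Theory Num.Theory.
Import numFieldNormedType.Exports.

Local Open Scope classical_set_scope.
Local Open Scope ring_scope.

(* Paths are functions on all of R of which only the values at times in
   [0, T] are used. The norm of ['M[R]_(m, n)] is the sup norm of the entries;
   being equivalent to the Euclidean norm, it gives the same (alpha-)Hölder
   conditions, the same C^k functions and the same boundedness conditions. *)

Section linear_algebra.
Context {R : realType}.

(* x (x) y in R^m (x) R^n = M_{m x n}, with entries x_i y_j. *)
Definition tens m n (x : 'cV[R]_m) (y : 'cV[R]_n) : 'M[R]_(m, n) := x *m y^T.

Definition dotv n (x y : 'cV[R]_n) : R := (x^T *m y) 0 0.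

Definition incr (V : zmodType) (W : R -> V) (s t : R) : V := W t - W s.

(* A linear map R^d -> V given by a matrix, as the family of the images of
   the canonical basis vectors. *)
Definition cols m d (A : 'M[R]_(m, d)) : 'I_d -> 'cV[R]_m := fun k => col k A.

End linear_algebra.

Section regularity.
Context {R : realType} {V W : normedModType R}.

(* For finite-dimensional V, this is k-times continuous differentiability. *)
Fixpoint Ck (k : nat) (g : V -> W) : Prop :=
  if k is k'.+1 then
    (forall x, differentiable g x) /\ (forall v, Ck k' ('D_v g))
  else continuous g.

Definition bounded_map (g : V -> W) : Prop := exists M, forall x, `|g x| <= M.

Definition bounded_D (g : V -> W) : Prop :=
  exists M, forall x v, `|'D_v g x| <= M * `|v|.

Definition bounded_D2 (g : V -> W) : Prop :=
  exists M, forall x v w, `|'D_w ('D_v g) x| <= M * `|v| * `|w|.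

End regularity.

Section lebesgue.
Context {R : realType}.

Definition oriented (V : zmodType) (I : R -> R -> V) (s t : R) : V :=
  if s <= t then I s t else - I t s.

(* The oriented entrywise integral of g over [s, t]. *)
Definition mxint m n (g : R -> 'M[R]_(m, n)) : R -> R -> 'M[R]_(m, n) :=
  oriented (fun s t =>
    \matrix_(i, j) Rintegral (@lebesgue_measure R) `[s, t] (fun r => g r i j)).

Definition C1_curve n (c : R -> 'cV[R]_n) : Prop :=
  (forall t, derivable c t 1) /\ continuous (derive1 c).

Definition curve_integral m n (G : 'cV[R]_n -> 'M[R]_(m, n))
    (c : R -> 'cV[R]_n) : 'cV[R]_m :=
  mxint (fun t => G (c t) *m derive1 c t) 0 1.

Definition conservative m n (G : 'cV[R]_n -> 'M[R]_(m, n)) : Prop :=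
  forall c1 c2, C1_curve c1 -> C1_curve c2 -> c1 0 = c2 0 -> c1 1 = c2 1 ->
  curve_integral G c1 = curve_integral G c2.

End lebesgue.

Section rough_paths.
Context {R : realType}.
Variables (alpha T : R).

Definition holder2 (V : normedModType R) (b : R) (A : R -> R -> V) : Prop :=
  exists C, forall s t, s \in `[0, T] -> t \in `[0, T] -> s != t ->
    `|A s t| / `|t - s| `^ b <= C.

Definition rough_path d (W : R -> 'cV[R]_d) (WW : R -> R -> 'M[R]_d) : Prop :=
  [/\ forall s u t, s \in `[0, T] -> u \in `[0, T] -> t \in `[0, T] ->
        WW s t - WW s u - WW u t = tens (incr W s u) (incr W u t),
      holder2 alpha (incr W) &
      holder2 (2 * alpha) WW].

Definition geometric_rough_path d (W : R -> 'cV[R]_d)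
    (WW : R -> R -> 'M[R]_d) : Prop :=
  rough_path W WW /\
  forall s t, s \in `[0, T] -> t \in `[0, T] ->
    2^-1 *: (WW s t + (WW s t)^T) = 2^-1 *: tens (incr W s t) (incr W s t).

Definition controlled d m (W : R -> 'cV[R]_d)
    (Y : R -> 'cV[R]_m) (Y' : R -> 'M[R]_(m, d)) : Prop :=
  [/\ holder2 alpha (incr Y),
      holder2 alpha (incr Y') &
      holder2 (2 * alpha) (fun s t => incr Y s t - Y' s *m incr W s t)].

End rough_paths.

Section rough_integral.
Context {R : realType}.

(* The subintervals [u, v] of the partition s < p_0 < ... < p_n of
   [s, p_n], see [itv_partition]. *)
Definition subintervals (s : R) (p : seq R) : seq (R * R) := zip (s :: p) p.

Definition mesh (s : R) (p : seq R) : R :=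
  \big[Num.max/0]_(uv <- subintervals s p) (uv.2 - uv.1).

(* The filter "|P| -> 0" on the partitions P of [s, t]; it is proper iff
   s <= t. *)
Definition mesh_to0 (s t : R) : set_system (seq R) :=
  [set S | exists2 delta, 0 < delta &
    forall p, itv_partition s t p -> mesh s p < delta -> S p].

(* Integrands have values in the linear maps R^d -> V: [Y r k] is the image of
   the k-th basis vector, and [Y' r a k] has Gubinelli-derivative direction a
   and integrator index k. For V = R^m, [Y r k] and [Y' r a k] are the columns
   with entries Y_r^{i,k} and (Y'_r)^{i,k}_a. *)
Definition rough_sum d (V : normedModType R)
    (W : R -> 'cV[R]_d) (WW : R -> R -> 'M[R]_d)
    (Y : R -> 'I_d -> V) (Y' : R -> 'I_d -> 'I_d -> V)
    (s : R) (p : seq R) : V :=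
  \sum_(uv <- subintervals s p)
    (\sum_k incr W uv.1 uv.2 k 0 *: Y uv.1 k +
     \sum_a \sum_k WW uv.1 uv.2 a k *: Y' uv.1 a k).

Definition rough_integrable d (V : normedModType R)
    (W : R -> 'cV[R]_d) (WW : R -> R -> 'M[R]_d)
    (Y : R -> 'I_d -> V) (Y' : R -> 'I_d -> 'I_d -> V) (s t : R) : Prop :=
  cvg (rough_sum W WW Y Y' s @ mesh_to0 s t).

Definition rough_integral d (V : normedModType R)
    (W : R -> 'cV[R]_d) (WW : R -> R -> 'M[R]_d)
    (Y : R -> 'I_d -> V) (Y' : R -> 'I_d -> 'I_d -> V) : R -> R -> V :=
  oriented (fun s t => lim (rough_sum W WW Y Y' s @ mesh_to0 s t)).

(* The controlled rough path (Phi(X), DPhi(X) X'), Phi having values in the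
   linear maps R^d -> V: the a-th Gubinelli derivative of Phi(X) is the
   derivative of Phi in the direction of the a-th column of X'. *)
Definition comp_path d n (V : normedModType R)
    (Phi : 'cV[R]_n -> 'I_d -> V) (X : R -> 'cV[R]_n) : R -> 'I_d -> V :=
  fun r k => Phi (X r) k.

Definition comp_deriv d n (V : normedModType R)
    (Phi : 'cV[R]_n -> 'I_d -> V) (X : R -> 'cV[R]_n)
    (X' : R -> 'M[R]_(n, d)) : R -> 'I_d -> 'I_d -> V :=
  fun r a k => 'D_(col a (X' r)) (Phi ^~ k) (X r).

Definition rough_integrable_comp d n (V : normedModType R)
    (W : R -> 'cV[R]_d) (WW : R -> R -> 'M[R]_d)
    (Phi : 'cV[R]_n -> 'I_d -> V) (X : R -> 'cV[R]_n)
    (X' : R -> 'M[R]_(n, d)) (s t : R) : Prop :=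
  rough_integrable W WW (comp_path Phi X) (comp_deriv Phi X X') s t.

Definition rough_integral_comp d n (V : normedModType R)
    (W : R -> 'cV[R]_d) (WW : R -> R -> 'M[R]_d)
    (Phi : 'cV[R]_n -> 'I_d -> V) (X : R -> 'cV[R]_n)
    (X' : R -> 'M[R]_(n, d)) (s t : R) : V :=
  rough_integral W WW (comp_path Phi X) (comp_deriv Phi X X') s t.

End rough_integral.

Section rough_equation.
Context {R : realType}.

Definition rde_solution (alpha T : R) d (W : R -> 'cV[R]_d)
    (WW : R -> R -> 'M[R]_d) (x0 : 'cV[R]_d) (f : 'cV[R]_d -> 'cV[R]_d)
    (sigma : 'cV[R]_d -> 'M[R]_d) (X : R -> 'cV[R]_d) (X' : R -> 'M[R]_d) :
    Prop :=
  controlled alpha T W X X' /\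
  forall t, t \in `[0, T] ->
    X t = x0 + mxint (fun r => f (X r)) 0 t +
          rough_integral_comp W WW (fun x => cols (sigma x)) X X' 0 t
    /\ X' t = sigma (X t).

(* eta(x) y = x (x) (sigma(x) y), evaluated at the basis vectors y = e_k. *)
Definition eta d (sigma : 'cV[R]_d -> 'M[R]_d) (x : 'cV[R]_d) :
    'I_d -> 'M[R]_d :=
  fun k => tens x (cols (sigma x) k).

Definition solution_lift d (W : R -> 'cV[R]_d) (WW : R -> R -> 'M[R]_d)
    (f : 'cV[R]_d -> 'cV[R]_d) (sigma : 'cV[R]_d -> 'M[R]_d)
    (X : R -> 'cV[R]_d) (s t : R) : 'M[R]_d :=
  mxint (fun r => tens (incr X s r) (f (X r))) s t
  + rough_integral_comp W WW (eta sigma) X (fun r => sigma (X r)) s t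
  - tens (X s) (rough_integral_comp W WW (fun x => cols (sigma x)) X
                  (fun r => sigma (X r)) s t).

End rough_equation.

Section fractional_brownian_motion.
Context {R : realType}.

(* The law of Z is N(0, s^2), with N(0, 0) the Dirac mass at 0; [normal_prob]
   is not the Dirac mass at standard deviation 0. *)
Definition centered_gaussian {disp : measure_display}
    {Omega : measurableType disp} (P : probability Omega R) (Z : Omega -> R) :
    Prop :=
  measurable_fun setT Z /\
  exists2 s : R, 0 <= s &
    forall A : set R, measurable A ->
      P (Z @^-1` A) = if s == 0 then \d_(0 : R) A else normal_prob 0 s A.

Definition fbm_cov (H s t : R) : R :=
  2^-1 * (s `^ (2 * H) + t `^ (2 * H) - `|t - s| `^ (2 * H)).

(* [B w t] is the value at time t of the sample path w. *)
Definition fbm {disp : measure_display} {Omega : measurableType disp}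
    (P : probability Omega R) (H T : R) d (B : Omega -> R -> 'cV[R]_d) : Prop :=
  [/\ forall n (t : 'I_n -> R) (c : 'I_n -> 'cV[R]_d),
        (forall i, t i \in `[0, T]) ->
        centered_gaussian P (fun w => \sum_i dotv (c i) (B w (t i))),
      forall s t (i j : 'I_d), s \in `[0, T] -> t \in `[0, T] ->
        ('E_P[fun w => (B w s i 0 * B w t j 0)%R] =
         ((i == j)%:R * fbm_cov H s t)%:E)%E &
      {ae P, forall w, {within `[0, T], continuous (B w)}}].

Definition dyadic (s t : R) (n i : nat) : R := s + (t - s) * i%:R / 2 ^+ n.

(* The iterated integral over [s, t] of (W^n_r - W_s) (x) dW^n_r, where W^n is
   the linear interpolation of W along the n-th dyadic partition of [s, t]. *)
Definition dyadic_lift d (W : R -> 'cV[R]_d) (s t : R) (n : nat) : 'M[R]_d :=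
  \sum_(0 <= i < 2 ^ n)
    let u := dyadic s t n i in let v := dyadic s t n i.+1 in
    tens (incr W s u + 2^-1 *: incr W u v) (incr W u v).

(* The canonical lift of fractional Brownian motion: the limit of the lifts
   of its dyadic piecewise linear interpolations. *)
Definition fbm_lift {disp : measure_display} {Omega : measurableType disp}
    (P : probability Omega R) (H alpha T : R) d (B : Omega -> R -> 'cV[R]_d)
    (BB : Omega -> R -> R -> 'M[R]_d) : Prop :=
  [/\ fbm P H T B,
      {ae P, forall w, geometric_rough_path alpha T (B w) (BB w)} &
      forall s t, 0 <= s -> s <= t -> t <= T ->
        {ae P, forall w, dyadic_lift (B w) s t n @[n --> \oo] --> BB w s t}].

End fractional_brownian_motion.

(* Main.v *)
(* A two-parameter map that differs from an additive map by O(|t - s|^theta),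
   theta > 1, has Riemann sums converging to that additive map; conversely the
   sewing lemma produces the additive map from a germ whose defect is of order
   theta. Sewing gives the integrals of sigma(X), eta(X) and (F sigma)(X)
   against W, each equal to its germ up to O(|t - s|^(3 alpha)). Substituting
   these expansions in the equation for X and in the definition of its lift, the
   second-order germ of F(X) along the lift of X becomes
     F(X_s) int_s^t f(X_r) dr + (germ of (F sigma)(X) along W)
   up to O(|t - s|^(3 alpha)), because 3 alpha <= 1 + alpha. Hence its Riemann
   sums converge to the additive right-hand side of the claim. *)
Require Import Defs.
From HB Require Import structures.
From mathcomp Require Import all_boot all_order all_algebra.
From mathcomp Require Import all_classical all_reals all_analysis.
From mathcomp Require Import ring lra.
Set Implicit Arguments.
Unset Strict Implicit.
Unset Printing Implicit Defensive.
Import Order.TTheory GRing.Theory Num.Theory.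
Import numFieldNormedType.Exports.
Local Open Scope classical_set_scope.
Local Open Scope ring_scope.

(** * Partitions and the sewing lemma *)

Section partitions.
Context {R : realType}.
Implicit Types (s t x : R) (p q r : seq R).

(** The comparison of the germs rests on one cancellation. By the product rule the Gubinelli
    derivative of eta(X) has a part X (x) Dsigma sigma and a part sigma (x) sigma. Subtracting X_s
    (x) int sigma(X) dW removes the first part, so that, apart from the drift, the lift of X expands
    as sigma(X_s) WW_{s,t} sigma(X_s)^T. Contracted with DF(X_s), this is exactly the term in which
    the product rule for F sigma differentiates F; the term in which it differentiates sigma comes
    from the expansion of the increment of X. The order 3 alpha exceeds 1 because alpha > 1/3. F and
    its derivatives may be unbounded, but X stays in a ball on [0, T], so all estimates on C^2
    functions are made on balls. Limits are taken along all partitions of small mesh, which are not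
    nested; two of them are compared through a common refinement. *)

Lemma itv_partition_mem s t p x : itv_partition s t p -> x \in p -> s < x <= t.
Proof.
elim: p s => [//|y p IH] s /= sp; have yp := itv_partition_cons sp.
have sy : s < y by case: sp => /= /andP[].
rewrite inE => /predU1P[->|xp]; first by rewrite sy (itv_partition_le yp).
by have /andP[yx ->] := IH _ yp xp; rewrite (lt_trans sy yx).
Qed.

Lemma itv_partition_last_mem s t p : s < t -> itv_partition s t p -> t \in p.
Proof.
case: p => [st /itv_partition_nil|y p st [_ /eqP<-] /=]; last exact: mem_last.
by move=> E; rewrite E ltxx in st.
Qed.

(** The refinement is the sorted union of the points, without repetition. *)
Lemma itv_partition_refinement s t p q :
  itv_partition s t p -> itv_partition s t q ->
  exists r, [/\ itv_partition s t r, {subset p <= r} & {subset q <= r}].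
Proof.
move=> pP qP; have := itv_partition_le pP; rewrite le_eqVlt => /predU1P[E|st].
  exists [::]; rewrite -E in pP qP *.
  by rewrite (itv_partitionxx pP) (itv_partitionxx qP).
pose r := sort <=%R (undup (p ++ q)).
have memr x : (x \in r) = (x \in p) || (x \in q).
  by rewrite mem_sort mem_undup mem_cat.
have rb x : x \in r -> s < x <= t.
  by rewrite memr => /orP[|]; exact: itv_partition_mem.
have rpath : path <%R s r.
  rewrite lt_path_sortedE sort_lt_sorted undup_uniq andbT.
  by apply/allP => x /rb/andP[].
have rP : itv_partition s (last s r) r by [].
have tr : t \in r by rewrite memr (itv_partition_last_mem st pP).
exists r; split; [|by move=> x xp; rewrite memr xp|].
  split=> //; rewrite eq_le; have /andP[_ ->] := itv_partition_mem rP tr.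
  rewrite andbT; have := mem_last s r; rewrite inE => /predU1P[->|/rb/andP[]//].
  exact: ltW.
by move=> x xq; rewrite memr xq orbT.
Qed.

Lemma mesh_cons s x p : mesh s (x :: p) = Num.max (x - s) (mesh x p).
Proof. by rewrite /mesh big_cons. Qed.

Lemma mesh_nil s : mesh s [::] = 0.
Proof. by rewrite /mesh big_nil. Qed.

Lemma mesh_cat_lt s p q (delta : R) :
  mesh s p < delta -> mesh (last s p) q < delta -> mesh s (p ++ q) < delta.
Proof.
elim: p s => [//|x p IH] s /=.
by rewrite !mesh_cons !gt_max => /andP[-> ?] ?; exact: IH.
Qed.

(** Steps of length delta / 2 keep the mesh strictly below delta; the induction is on the number of
    such steps needed to cover the interval. This is what makes the filter of small meshes
    proper. *)
Lemma itv_partition_mesh_lt s t (delta : R) : 0 < delta -> s <= t ->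
  exists2 p, itv_partition s t p & mesh s p < delta.
Proof.
move=> d0 st; have [n] : exists n : nat, t - s <= n%:R * (delta / 2).
  exists (Num.truncn ((t - s) / (delta / 2))).+1.
  rewrite -ler_pdivrMr ?divr_gt0//; apply/ltW.
  exact: truncnS_gt.
elim: n s st => [|n IH] s st.
  rewrite mul0r subr_le0 => ts; have -> : s = t by apply/le_anti/andP.
  by exists [::]; rewrite ?mesh_nil.
rewrite mulrSr mulrDl mul1r => H.
have [td|td] := ltP (t - s) delta.
  have [E|st'] := eqVneq s t.
    by exists [::]; rewrite ?mesh_nil ?E.
  exists [:: t]; first by apply: itv_partition1; rewrite lt_neqAle st' st.
  by rewrite mesh_cons mesh_nil gt_max td d0.
have [||p pP pd] := IH (s + delta / 2); [lra|lra|].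
exists (s + delta / 2 :: p).
  case: pP => pp pl; split=> //=; rewrite pp andbT; lra.
by rewrite mesh_cons gt_max pd andbT; lra.
Qed.

Global Instance mesh_to0_filter s t : Filter (mesh_to0 s t).
Proof.
split.
- by exists 1.
- move=> A B [e e0 eA] [d d0 dB]; exists (Num.min e d); first by rewrite lt_min e0.
  by move=> p pP; rewrite lt_min => /andP[pe pd]; split; [exact: eA|exact: dB].
- by move=> A B AB [e e0 eA]; exists e => // p pP pe; exact/AB/eA.
Qed.

Lemma mesh_to0_proper s t : s <= t -> ProperFilter (mesh_to0 s t).
Proof.
move=> st; apply: Build_ProperFilter_ex => A [e e0 eA].
by have [p pP pe] := itv_partition_mesh_lt e0 st; exists p; exact: eA.
Qed.

End partitions.

Section partition_sums.
Context {R : realType} {V : normedModType R}.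
Implicit Types (A : R -> R -> V) (s t : R) (p q : seq R).

Definition partition_sum A s p : V :=
  \sum_(uv <- subintervals s p) A uv.1 uv.2.

Lemma partition_sum_nil A s : partition_sum A s [::] = 0.
Proof. by rewrite /partition_sum big_nil. Qed.

Lemma partition_sum_cons A s t p :
  partition_sum A s (t :: p) = A s t + partition_sum A t p.
Proof. by rewrite /partition_sum big_cons. Qed.

Lemma partition_sum_cat A s p q :
  partition_sum A s (p ++ q) = partition_sum A s p + partition_sum A (last s p) q.
Proof.
elim: p s => [|x p IH] s /=; first by rewrite partition_sum_nil add0r.
by rewrite !partition_sum_cons IH addrA.
Qed.

Lemma partition_sumB A A' s p :
  partition_sum (fun u v => A u v - A' u v) s p =
  partition_sum A s p - partition_sum A' s p.
Proof. by rewrite /partition_sum sumrB. Qed.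

End partition_sums.

Section two_parameter_maps.
Context {R : realType} {V : normedModType R}.
Variable T : R.
Implicit Types (A I : R -> R -> V) (s t u : R) (p q : seq R).

(** The Hölder quotient multiplied out and restricted to [s < t]. The sign of [C] is recorded so
    that bounds can be multiplied. *)
Definition is_O (theta : R) A : Prop :=
  exists2 C, 0 <= C &
    forall s t, 0 <= s -> s < t -> t <= T -> `|A s t| <= C * (t - s) `^ theta.

Definition additive_on I : Prop :=
  forall s u t, 0 <= s -> s <= u -> u <= t -> t <= T -> I s t = I s u + I u t.

Lemma additive_on_diag I s : additive_on I -> 0 <= s -> s <= T -> I s s = 0.
Proof.
move=> addI s0 sT; have /eqP := addI _ _ _ s0 (lexx s) (lexx s) sT.
by rewrite -subr_eq subrr eq_sym => /eqP.
Qed.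

Lemma partition_sum_additive I s t p : additive_on I ->
  0 <= s -> t <= T -> itv_partition s t p -> partition_sum I s p = I s t.
Proof.
move=> addI; elim: p s => [|x p IH] s s0 tT sp.
  by rewrite partition_sum_nil (itv_partition_nil sp) additive_on_diag//
    -(itv_partition_nil sp).
have xp := itv_partition_cons sp; have xt := itv_partition_le xp.
have sx : s <= x by case: sp => /= /andP[/ltW].
by rewrite partition_sum_cons IH// -?addI//; exact: le_trans sx.
Qed.

(** On a bounded time interval the surplus power of t - s is at most a power of T, absorbed in the
    constant. *)
Lemma is_O_le theta theta' A : 0 < T -> theta' <= theta ->
  is_O theta A -> is_O theta' A.
Proof.
move=> T0 tt' [C C0 CA]; exists (C * T `^ (theta - theta')).
  by rewrite mulr_ge0// powR_ge0.
move=> s t s0 st tT; apply: le_trans (CA _ _ s0 st tT) _.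
have ts : 0 < t - s by rewrite subr_gt0.
rewrite -mulrA; apply: ler_wpM2l => //.
rewrite -[X in _ `^ X <= _](subrK theta') (@powRD _ (t - s)); last first.
  by rewrite (gt_eqF ts) implybT.
apply: ler_wpM2r; first exact: powR_ge0.
by apply: ge0_ler_powR; rewrite ?nnegrE ?subr_ge0 ?(ltW T0) ?(ltW st)//; lra.
Qed.

(** In each (v - u)^theta one factor v - u is kept, and these sum to t - s; the remaining power is
    at most delta^(theta - 1). *)
Lemma partition_sum_le C theta A s t p delta :
  0 <= C -> 1 <= theta ->
  (forall u v, 0 <= u -> u < v -> v <= T -> `|A u v| <= C * (v - u) `^ theta) ->
  0 <= s -> t <= T -> itv_partition s t p -> 0 < delta -> mesh s p < delta ->
  `|partition_sum A s p| <= C * delta `^ (theta - 1) * (t - s).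
Proof.
move=> C0 th1 CA + tT + d0; elim: p s => [|x p IH] s s0 sp.
  by rewrite partition_sum_nil normr0 (itv_partition_nil sp) subrr mulr0.
have xp := itv_partition_cons sp; have xt := itv_partition_le xp.
have sx : s < x by case: sp => /= /andP[].
rewrite mesh_cons gt_max partition_sum_cons => /andP[xd pd].
apply: le_trans (ler_normD _ _) _.
have -> : t - s = (x - s) + (t - x) by ring.
rewrite [leRHS]mulrDr; apply: lerD; last first.
  by apply: IH => //; lra.
apply: le_trans (CA _ _ s0 sx _) _; first exact: le_trans xt tT.
rewrite -mulrA; apply: ler_wpM2l => //.
have xs : 0 < x - s by rewrite subr_gt0.
rewrite -(@mulr_powRB1 _ (x - s) theta) ?(ltW xs)//; last lra.
rewrite mulrC; apply: ler_wpM2r; first exact: ltW.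
by apply: ge0_ler_powR; rewrite ?nnegrE ?subr_ge0 ?(ltW sx) ?(ltW xd) ?(ltW d0).
Qed.

Lemma exists_powR_lt (theta eps : R) : 0 < theta -> 0 < eps ->
  exists2 delta : R, 0 < delta & delta `^ theta < eps.
Proof.
move=> th e0; exists ((eps / 2) `^ theta^-1); first by rewrite powR_gt0// divr_gt0.
rewrite -powRrM mulVf ?gt_eqF// powRr1; first by lra.
by rewrite divr_ge0// ltW.
Qed.

(** The sums of [I] telescope, so the error is the partition sum of [I - A], which vanishes with the
    mesh as theta > 1. *)
Lemma partition_sum_cvg theta A I s t : 1 < theta ->
  additive_on I -> is_O theta (fun u v => I u v - A u v) ->
  0 <= s -> t <= T -> partition_sum A s @ mesh_to0 s t --> I s t.
Proof.
move=> th1 addI [C C0 CA] s0 tT.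
apply/cvgrPdist_lt => e e0.
(* The absolute value is there because [s <= t] is known only once a partition is given; the final 1
   makes [K] a legitimate divisor even for C = 0. *)
have [K K0 KE] : exists2 K, 0 < K & K = C * (`|t - s| + 1) + 1.
  by eexists; last reflexivity; rewrite ltr_wpDl// mulr_ge0// addr_ge0.
have [||d d0 de] := @exists_powR_lt (theta - 1) (e / K); rewrite ?subr_gt0 ?divr_gt0//.
exists d => // p pP pd.
rewrite -(partition_sum_additive addI s0 tT pP) -partition_sumB.
apply: le_lt_trans (partition_sum_le C0 (ltW th1) CA s0 tT pP d0 pd) _.
have st := itv_partition_le pP.
move: de; rewrite ltr_pdivlMr// KE ger0_norm ?subr_ge0// => de.
apply: le_lt_trans de; have := powR_ge0 d (theta - 1).
have : 0 <= t - s by rewrite subr_ge0.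
have := C0; nra.
Qed.

End two_parameter_maps.

(** * The sewing lemma along arbitrary partitions *)

Section sewing.
Context {R : realType} {V : completeNormedModType R}.
Variables (T theta C : R) (A : R -> R -> V).
Hypotheses (theta_gt1 : 1 < theta) (C_ge0 : 0 <= C).
Hypothesis A_delta : forall s u t, 0 <= s -> s <= u -> u <= t -> t <= T ->
  `|A s t - A s u - A u t| <= C * (t - s) `^ theta.

Let half_powR : 2^-1 `^ theta < 2^-1 :> R.
Proof.
have -> : theta = 1 + (theta - 1) by ring.
rewrite powRD ?powRr1 ?invr_ge0//; last by rewrite invr_eq0 pnatr_eq0 implybT.
have h : 2^-1 `^ (theta - 1) < 1 `^ (theta - 1) :> R.
  by apply: gt0_ltr_powR; rewrite ?subr_gt0 ?nnegrE//; lra.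
rewrite powR1 in h; lra.
Qed.

Let K := 2 * C / (1 - 2 * 2^-1 `^ theta).

Let K_ge0 : 0 <= K.
Proof. by rewrite divr_ge0//; have := C_ge0; have := half_powR; lra. Qed.

Let A_diag s : 0 <= s -> s <= T -> A s s = 0.
Proof.
move=> s0 sT; have := A_delta s0 (lexx s) (lexx s) sT.
rewrite !subrr powR0 ?gt_eqF//; last by have := theta_gt1; lra.
by rewrite mulr0 sub0r normrN normr_le0 => /eqP.
Qed.

(* Bisection: cutting a partition at the two points around the midpoint
   leaves two partitions of intervals of at most half the length, and
   [K = 2 * C + 2 * K / 2 ^ theta]. *)
Lemma partition_sum_sub_le s t p : 0 <= s -> t <= T -> itv_partition s t p ->
  `|A s t - partition_sum A s p| <= K * (t - s) `^ theta.
Proof.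
have [n] := ubnP (size p); elim: n s t p => // n IH s t p pn s0 tT sp.
have := itv_partition_le sp; rewrite le_eqVlt => /predU1P[st|st].
  rewrite -st in sp tT *; rewrite (itv_partitionxx sp) partition_sum_nil subr0.
  by rewrite A_diag// normr0 mulr_ge0// powR_ge0.
pose m := (s + t) / 2.
have [u [v [p1 [p2 [E [um mv]]]]]] : exists u v p1 p2,
    p = p1 ++ v :: p2 /\ (last s p1 = u /\ u <= m /\ m < v).
  have : m < last s p by case: sp => _ /eqP->; rewrite /m; lra.
  have : s <= m by rewrite /m; lra.
  elim: (p) {pn sp} s {s0 st m} (m) => [|x q IHq] s m sm.
    by move=> /(le_lt_trans sm); rewrite ltxx.
  have [xm|mx] := leP x m.
    move=> /= /(IHq _ _ xm)[u [v [p1 [p2 [-> [<- um]]]]]].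
    by exists (last s (x :: p1)), v, (x :: p1), p2.
  by move=> _; exists s, x, [::], q.
move: um mv => um [um' mv].
have [sp1 up2] : itv_partition s u p1 /\ itv_partition v t p2 /\ u < v.
  case: sp => + /eqP; rewrite E cat_path last_cat /= um => /and3P[? ? ?] ?.
  by split; [split=> //; exact/eqP|split=> //; split=> //; exact/eqP].
have [vp2 uv] := up2.
have su := itv_partition_le sp1; have vt := itv_partition_le vp2.
rewrite E partition_sum_cat um partition_sum_cons.
have szE : size p = (size p1 + (size p2).+1)%N by rewrite E size_cat.
have pn' : (size p1 + (size p2).+1 <= n)%N by rewrite -szE.
have p1n : (size p1 < n)%N by apply: leq_trans pn'; rewrite addnS ltnS leq_addr.
have p2n : (size p2 < n)%N by apply: leq_trans pn'; exact: leq_addl.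
have H1 := IH _ _ _ p1n s0 (le_trans (ltW uv) (le_trans vt tT)) sp1.
have H2 := IH _ _ _ p2n (le_trans (le_trans s0 su) (ltW uv)) tT vp2.
have H3 := A_delta s0 su (le_trans (ltW uv) vt) tT.
have H4 := A_delta (le_trans s0 su) (ltW uv) vt tT.
have ts0 : 0 < t - s by rewrite subr_gt0.
have th0 : 0 <= theta by have := theta_gt1; lra.
have pw x : 0 <= x -> x <= (t - s) / 2 ->
    x `^ theta <= (t - s) `^ theta * 2^-1 `^ theta.
  move=> x0 xs; rewrite -powRM ?invr_ge0 ?(ltW ts0)//.
  by apply: ge0_ler_powR; rewrite ?nnegrE// mulr_ge0 ?invr_ge0// ltW.
have P1 := pw (u - s) _ _; have P2 := pw (t - v) _ _.
have {}P1 : (u - s) `^ theta <= (t - s) `^ theta * 2^-1 `^ theta.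
  by apply: P1; rewrite ?subr_ge0//; move: um'; rewrite /m; lra.
have {}P2 : (t - v) `^ theta <= (t - s) `^ theta * 2^-1 `^ theta.
  by apply: P2; rewrite ?subr_ge0//; move: mv; rewrite /m; lra.
have P4 : (t - u) `^ theta <= (t - s) `^ theta.
  by apply: ge0_ler_powR; rewrite ?nnegrE ?(ltW ts0)//; lra.
(* The defects at (s, u, t) and (u, v, t) account for 2 * C; the term [A u v] of the interval
   straddling the midpoint cancels exactly and needs no estimate. *)
have -> : A s t - (partition_sum A s p1 + (A u v + partition_sum A v p2)) =
    (A s t - A s u - A u t) + (A u t - A u v - A v t) +
    (A s u - partition_sum A s p1) + (A v t - partition_sum A v p2).
  rewrite !opprD !addrA [RHS](ACl (1*8*5*10*(2*7)*(3*4)*(6*9)))/=.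
  by rewrite !addNr !addr0.
apply: le_trans (ler_normD _ _) _; apply: le_trans (lerD (ler_normD _ _) (lexx _)) _.
apply: le_trans (lerD (lerD (ler_normD _ _) (lexx _)) (lexx _)) _.
have KE : K = 2 * C + 2 * K * 2^-1 `^ theta.
  rewrite /K; field; have := half_powR; lra.
have -> : K * (t - s) `^ theta = C * (t - s) `^ theta + C * (t - s) `^ theta +
    K * ((t - s) `^ theta * 2^-1 `^ theta) + K * ((t - s) `^ theta * 2^-1 `^ theta).
  by rewrite {1}KE; ring.
apply: lerD; last exact: le_trans H2 (ler_wpM2l K_ge0 P2).
apply: lerD; last exact: le_trans H1 (ler_wpM2l K_ge0 P1).
apply: lerD => //; exact: le_trans H4 (ler_wpM2l C_ge0 P4).
Qed.

(** The points of [r] inside an interval of [p] form a partition of it, to which the bisection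
    estimate applies; the induction cuts [r] at the first point of [p]. *)
Lemma partition_sum_refine_le s t p r : 0 <= s -> t <= T ->
  itv_partition s t p -> itv_partition s t r -> {subset p <= r} ->
  `|partition_sum A s p - partition_sum A s r| <=
  partition_sum (fun u v => K * (v - u) `^ theta) s p.
Proof.
move=> + tT; elim: p s r => [|x p IH] s r s0 sp sr psub.
  rewrite -(itv_partition_nil sp) in sr.
  by rewrite (itv_partitionxx sr) !partition_sum_nil subrr normr0.
have xp := itv_partition_cons sp; have xt := itv_partition_le xp.
have sx : s < x by case: sp => /= /andP[].
(* On the last interval of [p] nothing is left to cut; otherwise [x < t] strictly, as cutting [r] at
   [x] requires. *)
have [E|p0] := eqVneq p [::].
  rewrite E in xp *; rewrite !partition_sum_cons !partition_sum_nil !addr0.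
  have E' := itv_partition_nil xp; rewrite -E' in sr tT.
  exact: partition_sum_sub_le.
have {}xt : x < t by apply: itv_partition_size_neq0 xp; case: (p) p0.
have xr : x \in r by apply: psub; rewrite mem_head.
have sorted_r : sorted <%R r by case: sr => /path_sorted.
have r1 := itv_partitionLP sx xt sr; have r2 := itv_partitionRP sx xt sr.
rewrite (in_itv_partition sorted_r xr) partition_sum_cat !partition_sum_cons.
have -> : last s (itv_partitionL r x) = x by case: r1 => _ /eqP.
rewrite opprD addrACA; apply: le_trans (ler_normD _ _) _; apply: lerD.
  by apply: partition_sum_sub_le => //; exact: le_trans (ltW xt) tT.
apply: IH => //; first exact: le_trans s0 (ltW sx).
move=> y yp; rewrite mem_filter psub ?inE ?yp ?orbT// andbT.
by have /andP[] := itv_partition_mem xp yp.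
Qed.

(** By completeness it suffices that the sums concentrate around one value. The sum along any fixed
    partition of small mesh serves: each further one is within e / 2 of the sum along a common
    refinement, and so is the fixed one. *)
Lemma partition_sum_is_cvg s t : 0 <= s -> s <= t -> t <= T ->
  cvg (partition_sum A s @ mesh_to0 s t).
Proof.
move=> s0 st tT; have PF := mesh_to0_proper st.
apply: cauchy_cvg; apply: cauchy_exP => e e0.
pose L := K * (t - s) + 1.
have L0 : 0 < L by rewrite ltr_wpDl// mulr_ge0// subr_ge0.
have [||d d0 de] := @exists_powR_lt R (theta - 1) (e / 2 / L); rewrite ?subr_gt0 ?divr_gt0//.
have close p r : itv_partition s t p -> mesh s p < d -> itv_partition s t r ->
    {subset p <= r} -> `|partition_sum A s p - partition_sum A s r| < e / 2.
  move=> sp pd sr pr.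
  apply: le_lt_trans (partition_sum_refine_le s0 tT sp sr pr) _.
  apply: le_lt_trans (ler_norm _) _.
  have := @partition_sum_le R R T K theta (fun u v => K * (v - u) `^ theta)
    s t p d K_ge0 (ltW theta_gt1) _ s0 tT sp d0 pd.
  move=> /(_ _)/le_lt_trans; apply.
    by move=> u v _ _ _; rewrite ger0_norm// mulr_ge0// powR_ge0.
  move: de; rewrite ltr_pdivlMr// /L => de; apply: le_lt_trans de.
  have := powR_ge0 d (theta - 1); lra.
have [p0 p0P p0d] := itv_partition_mesh_lt d0 st.
exists (partition_sum A s p0); exists d => // p pP pd.
have [r [rP p0r pr]] := itv_partition_refinement p0P pP.
rewrite /ball_ -ball_normE /ball_/=.
have -> : partition_sum A s p0 - partition_sum A s p =
  (partition_sum A s p0 - partition_sum A s r) -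
  (partition_sum A s p - partition_sum A s r) by rewrite opprB addrA subrK.
apply: le_lt_trans (ler_normB _ _) _; rewrite (splitr e).
by apply: ltrD; exact: close.
Qed.

(** Additivity holds because a fine partition of [s, u] followed by one of [u, t] is a fine
    partition of [s, t]. The error bound passes to the limit with the same [K], the bisection
    estimate being uniform in the partition. *)
Lemma sewing : exists2 I : R -> R -> V, additive_on T I &
  is_O T theta (fun s t => I s t - A s t).
Proof.
pose I s t := lim (partition_sum A s @ mesh_to0 s t).
have IP s t : 0 <= s -> s <= t -> t <= T -> forall e, 0 < e ->
    exists2 d, 0 < d & forall p, itv_partition s t p -> mesh s p < d ->
      `|I s t - partition_sum A s p| < e.
  move=> s0 st tT e e0; have /cvgrPdist_lt := partition_sum_is_cvg s0 st tT.
  by move=> /(_ _ e0).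
exists I.
  move=> s u t s0 su ut tT; apply/eqP; rewrite -subr_eq0 -normr_le0.
  apply/ler_addgt0Pr => e e0; rewrite add0r.
  have e3 : 0 < e / 3 by rewrite divr_gt0.
  have [d1 d10 H1] := IP s u s0 su (le_trans ut tT) _ e3.
  have [d2 d20 H2] := IP u t (le_trans s0 su) ut tT _ e3.
  have [d3 d30 H3] := IP s t s0 (le_trans su ut) tT _ e3.
  pose d := Num.min d1 (Num.min d2 d3).
  have d0 : 0 < d by rewrite !lt_min d10 d20.
  have [p pP pd] := itv_partition_mesh_lt d0 su.
  have [q qP qd] := itv_partition_mesh_lt d0 ut.
  have lp : last s p = u by case: pP => _ /eqP.
  have := mesh_cat_lt (s := s) (p := p) (q := q) pd; rewrite lp => /(_ qd) pqd.
  move: (pd) (qd) (pqd); rewrite !lt_min => /andP[p1 _] /and3P[_ q2 _] /and3P[_ _ r3].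
  have {}H1 := H1 _ pP p1; have {}H2 := H2 _ qP q2.
  have {}H3 := H3 _ (itv_partition_cat pP qP) r3.
  rewrite partition_sum_cat lp in H3.
  have -> : I s t - (I s u + I u t) =
      (I s t - (partition_sum A s p + partition_sum A u q)) -
      (I s u - partition_sum A s p) - (I u t - partition_sum A u q).
    by rewrite !opprD !opprK !addrA (ACl (1*4*6*(2*5)*(3*7)))/= !addNr !addr0.
  apply: le_trans (ler_normB _ _) _.
  have := ler_normB (I s t - (partition_sum A s p + partition_sum A u q))
    (I s u - partition_sum A s p).
  lra.
exists K => // s t s0 st tT; apply/ler_addgt0Pr => e e0.
have [d d0 dI] := IP s t s0 (ltW st) tT _ e0.
have [p pP pd] := itv_partition_mesh_lt d0 (ltW st).
have := dI _ pP pd; have := partition_sum_sub_le s0 tT pP.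
have := ler_normB (I s t - partition_sum A s p) (A s t - partition_sum A s p).
by rewrite opprB addrA subrK; lra.
Qed.

End sewing.

(** * Orders of increments *)

Section big_O.
Context {R : realType} {V : normedModType R}.
Variable T : R.
Implicit Types (A B : R -> R -> V) (theta : R).

Lemma eq_is_O theta A B :
  (forall s t, 0 <= s -> s < t -> t <= T -> A s t = B s t) ->
  is_O T theta A -> is_O T theta B.
Proof.
by move=> AB [C C0 CA]; exists C => // s t s0 st tT; rewrite -AB//; exact: CA.
Qed.

Lemma is_OD theta A B : is_O T theta A -> is_O T theta B ->
  is_O T theta (fun s t => A s t + B s t).
Proof.
move=> [C C0 CA] [D D0 DB]; exists (C + D); first exact: addr_ge0.
move=> s t s0 st tT; rewrite mulrDl; apply: le_trans (ler_normD _ _) _.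
by apply: lerD; [exact: CA|exact: DB].
Qed.

Lemma is_ON theta A : is_O T theta A -> is_O T theta (fun s t => - A s t).
Proof. by move=> [C C0 CA]; exists C => // s t; rewrite normrN; exact: CA. Qed.

Lemma is_OB theta A B : is_O T theta A -> is_O T theta B ->
  is_O T theta (fun s t => A s t - B s t).
Proof. by move=> OA /is_ON; exact: is_OD. Qed.

Lemma is_O0 theta : is_O T theta (fun _ _ => 0 : V).
Proof. by exists 0 => // *; rewrite normr0 mul0r. Qed.

Lemma is_O_sum n theta (A : 'I_n -> R -> R -> V) :
  (forall i, is_O T theta (A i)) -> is_O T theta (fun s t => \sum_i A i s t).
Proof.
elim: n A => [A _|n IH A OA].
  by apply: eq_is_O (is_O0 _) => *; rewrite big_ord0.
apply: (@eq_is_O _ (fun s t => A ord0 s t + \sum_i A (lift ord0 i) s t)).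
  by move=> *; rewrite big_ord_recl.
by apply: is_OD => //; exact: IH.
Qed.

Lemma holder2_is_O alpha A : holder2 T alpha A -> is_O T alpha A.
Proof.
move=> [C CA]; exists `|C| => // s t s0 st tT.
have ts : 0 < t - s by rewrite subr_gt0.
have := CA s t; rewrite !in_itv/= s0 (le_trans (ltW st) tT) tT.
rewrite (le_trans s0 (ltW st)) lt_eqF// (gtr0_norm ts) => /(_ isT isT isT).
rewrite ler_pdivrMr ?powR_gt0// => /le_trans; apply.
by apply: ler_wpM2r; rewrite ?powR_ge0 ?ler_norm.
Qed.

(* For three-point maps such as the sewing defect [A s t - A s u - A u t], and
   the products [A s u * B u t] into which it decomposes. *)
Definition is_O3 theta (D : R -> R -> R -> V) : Prop :=
  exists2 C, 0 <= C & forall s u t, 0 <= s -> s < u -> u < t -> t <= T ->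
    `|D s u t| <= C * (t - s) `^ theta.

Lemma eq_is_O3 theta (D E : R -> R -> R -> V) :
  (forall s u t, 0 <= s -> s < u -> u < t -> t <= T -> D s u t = E s u t) ->
  is_O3 theta D -> is_O3 theta E.
Proof.
move=> DE [C C0 CA]; exists C => // s u t s0 su ut tT.
by rewrite -DE//; exact: CA.
Qed.

Lemma is_O3D theta (D E : R -> R -> R -> V) : is_O3 theta D -> is_O3 theta E ->
  is_O3 theta (fun s u t => D s u t + E s u t).
Proof.
move=> [C C0 CA] [C' C'0 DB]; exists (C + C'); first exact: addr_ge0.
move=> s u t s0 su ut tT; rewrite mulrDl; apply: le_trans (ler_normD _ _) _.
by apply: lerD; [exact: CA|exact: DB].
Qed.

Lemma is_O3N theta (D : R -> R -> R -> V) :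
  is_O3 theta D -> is_O3 theta (fun s u t => - D s u t).
Proof. by move=> [C C0 CA]; exists C => // s u t; rewrite normrN; exact: CA. Qed.

Lemma is_O3_sum n theta (D : 'I_n -> R -> R -> R -> V) :
  (forall i, is_O3 theta (D i)) -> is_O3 theta (fun s u t => \sum_i D i s u t).
Proof.
elim: n D => [D _|n IH D OD].
  by exists 0 => // *; rewrite big_ord0 normr0 mul0r.
apply: (@eq_is_O3 _ (fun s u t => D ord0 s u t + \sum_i D (lift ord0 i) s u t)).
  by move=> *; rewrite big_ord_recl.
by apply: is_O3D => //; exact: IH.
Qed.

End big_O.

Section big_O_scalar.
Context {R : realType}.
Variable T : R.
Implicit Types (A B : R -> R -> R) (f g : R -> R) (a b : R).

Definition bounded_path f : Prop :=
  exists2 M, 0 <= M & forall s, 0 <= s -> s <= T -> `|f s| <= M.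

(** Both u - s and t - u are at most t - s, so the orders add. *)
Lemma is_O3M a b A B : 0 <= a -> 0 <= b -> is_O T a A -> is_O T b B ->
  is_O3 T (a + b) (fun s u t => A s u * B u t).
Proof.
move=> a0 b0 [C C0 CA] [D D0 DB]; exists (C * D); first exact: mulr_ge0.
move=> s u t s0 su ut tT.
have st := lt_trans su ut; rewrite normrM powRD; last first.
  by rewrite [t - s == 0]gt_eqF ?implybT// subr_gt0.
rewrite mulrACA; apply: ler_pM => //.
  apply: le_trans (CA _ _ s0 su (le_trans (ltW ut) tT)) _.
  apply: ler_wpM2l => //; apply: ge0_ler_powR; rewrite ?nnegrE//; lra.
apply: le_trans (DB _ _ (le_trans s0 (ltW su)) ut tT) _.
apply: ler_wpM2l => //; apply: ge0_ler_powR; rewrite ?nnegrE//; lra.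
Qed.

Lemma is_OMl a f A : bounded_path f -> is_O T a A ->
  is_O T a (fun s t => f s * A s t).
Proof.
move=> [M M0 fM] [C C0 CA]; exists (M * C); first exact: mulr_ge0.
move=> s t s0 st tT; rewrite normrM -mulrA; apply: ler_pM => //; last exact: CA.
by apply: fM => //; exact: le_trans (ltW st) tT.
Qed.

Lemma is_OMr a f A : bounded_path f -> is_O T a A ->
  is_O T a (fun s t => A s t * f t).
Proof.
move=> [M M0 fM] [C C0 CA]; exists (M * C); first exact: mulr_ge0.
move=> s t s0 st tT; rewrite normrM -mulrA mulrC; apply: ler_pM => //.
  by apply: fM => //; exact: le_trans (ltW st).
exact: CA.
Qed.

(** Discrete product rule, with one factor taken at [t] and the other at [s]. *)
Lemma is_O_incrM a f g : bounded_path f -> bounded_path g ->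
  is_O T a (incr f) -> is_O T a (incr g) ->
  is_O T a (incr (fun t => f t * g t)).
Proof.
move=> bf bg Of Og.
apply: (@eq_is_O _ _ _ _ (fun s t => incr f s t * g t + f s * incr g s t)).
  by move=> s t _ _ _; rewrite /incr; ring.
by apply: is_OD; [exact: is_OMr|exact: is_OMl].
Qed.

Lemma is_O_incr_sum n a (f : 'I_n -> R -> R) :
  (forall i, is_O T a (incr (f i))) -> is_O T a (incr (fun t => \sum_i f i t)).
Proof.
move=> Of; apply: eq_is_O (is_O_sum Of) => s t _ _ _.
by rewrite /incr sumrB.
Qed.

End big_O_scalar.

(** * Passage between matrices and their entries *)

Section matrix_norm.
Context {R : realType}.

Lemma ler_mx_norm_entry m n (A : 'M[R]_(m, n)) i j : `|A i j| <= `|A|.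
Proof.
by rewrite [leRHS]/Num.Def.normr/= mx_normrE; exact: (le_bigmax _ _ (i, j)).
Qed.

Lemma mx_norm_le m n (A : 'M[R]_(m, n)) (M : R) : 0 <= M ->
  (forall i j, `|A i j| <= M) -> `|A| <= M.
Proof.
by move=> M0 AM; rewrite [leLHS]/Num.Def.normr/= mx_normrE (bigmax_le _ M0).
Qed.

Lemma is_O_entry T theta m n (A : R -> R -> 'M[R]_(m, n)) i j :
  is_O T theta A -> is_O T theta (fun s t => A s t i j).
Proof.
move=> [C C0 CA]; exists C => // s t s0 st tT.
exact: le_trans (ler_mx_norm_entry _ _ _) (CA _ _ s0 st tT).
Qed.

(** The norm is dominated by the sum of the absolute values of the entries, which merges the
    constants of all entries into one. *)
Lemma is_O_mx T theta m n (A : R -> R -> 'M[R]_(m, n)) :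
  (forall i j, is_O T theta (fun s t => A s t i j)) -> is_O T theta A.
Proof.
move=> OA.
have [] : is_O T theta (fun s t => \sum_i \sum_j `|A s t i j|).
  apply: is_O_sum => i; apply: is_O_sum => j.
  by have [C C0 CA] := OA i j; exists C => // *; rewrite normr_id; exact: CA.
move=> C C0 CA; exists C => // s t s0 st tT.
apply: le_trans (CA _ _ s0 st tT); apply: le_trans (ler_norm _).
have sum0 i : 0 <= \sum_j `|A s t i j| by exact: sumr_ge0.
apply: mx_norm_le => [|i j]; first exact: sumr_ge0.
rewrite (bigD1 i)//= (bigD1 j)//= -addrA lerDl addr_ge0// sumr_ge0// => *.
Qed.

End matrix_norm.

(** * C^k functions along a path *)

Section Ck_functions.
Context {R : realType} {V : normedModType R}.
Implicit Types (f g : V -> R).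

(** [Ck] asks for continuity only at the top order; below it, continuity has to be recovered from
    differentiability. *)
Lemma CkS_Ck (W : normedModType R) k (f : V -> W) : Ck k.+1 f -> Ck k f.
Proof.
elim: k f => [|k IH] f [df Df] /=; last by split=> // v; exact/IH/Df.
by move=> x; exact: differentiable_continuous.
Qed.

Lemma Ck_cst k (c : R) : Ck k (fun _ : V => c).
Proof.
elim: k c => [c x|k IH c]; first exact: cvg_cst.
split=> [x|v]; first exact: differentiable_cst.
rewrite (_ : 'D_v _ = fun=> 0); first exact: IH.
by apply/funext => x; rewrite derive_cst.
Qed.

Lemma CkD k f g : Ck k f -> Ck k g -> Ck k (fun x => f x + g x).
Proof.
elim: k f g => [f g cf cg x|k IH f g [df Df] [dg Dg]].
  by apply: cvgD; [exact: cf|exact: cg].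
split=> [x|v]; first exact: differentiableD.
rewrite (_ : 'D_v _ = fun x => 'D_v f x + 'D_v g x).
  by apply: IH; [exact: Df|exact: Dg].
by apply/funext => x; rewrite deriveD//; exact: diff_derivable.
Qed.

Lemma CkM k f g : Ck k f -> Ck k g -> Ck k (fun x => f x * g x).
Proof.
elim: k f g => [f g cf cg x|k IH f g].
  by apply: cvgM; [exact: cf|exact: cg].
move=> Cf Cg; have [df Df] := Cf; have [dg Dg] := Cg.
split=> [x|v]; first exact: differentiableM.
rewrite (_ : 'D_v _ = fun x => f x * 'D_v g x + g x * 'D_v f x).
  apply: CkD; apply: IH; [exact: CkS_Ck Cf|exact: Dg|exact: CkS_Ck Cg|exact: Df].
by apply/funext => x; rewrite deriveM//; exact: diff_derivable.
Qed.

Lemma Ck_sum k n (f : 'I_n -> V -> R) :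
  (forall i, Ck k (f i)) -> Ck k (fun x => \sum_i f i x).
Proof.
elim: n f => [f _|n IH f Cf].
  rewrite (_ : (fun _ => _) = fun=> 0); first exact: Ck_cst.
  by apply/funext => x; rewrite big_ord0.
rewrite (_ : (fun _ => _) = fun x => f ord0 x + \sum_i f (lift ord0 i) x).
  by apply: CkD => //; exact: IH.
by apply/funext => x; rewrite big_ord_recl.
Qed.

(** Reduces matrix-valued coefficients to scalar functions, on which all the calculus below is
    done. *)
Lemma Ck_entry k m n (M : V -> 'M[R]_(m, n)) i j :
  Ck k M -> Ck k (fun x => M x i j).
Proof.
elim: k M => [M cM x|k IH M [dM DM]].
  apply: (@continuous_comp _ _ _ M (fun A : 'M[R]_(m, n) => A i j)).
    exact: cM.
  exact: coord_continuous.
split=> [x|v].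
  apply: (@differentiable_comp _ _ _ _ M (fun A : 'M[R]_(m, n) => A i j)) => //.
  exact: differentiable_coord.
rewrite (_ : 'D_v _ = fun x => ('D_v M x) i j); first exact/IH/DM.
by apply/funext => x; rewrite derive_mx ?mxE//; exact: diff_derivable.
Qed.

End Ck_functions.

Section Ck_vector_space.
Context {R : realType} {n : nat}.
Implicit Types (f : 'cV[R]_n -> R) (x y h v : 'cV[R]_n) (r : R).

Lemma derive_coord i v x : 'D_v (fun y : 'cV[R]_n => y i 0) x = v i 0.
Proof.
have := @derive_mx R _ _ _ (@id 'cV[R]_n) x v (@derivable_id _ _ x v).
by rewrite derive_id => /(congr1 (fun A : 'cV_n => A i 0)); rewrite mxE.
Qed.

Lemma Ck_coord k i : Ck k (fun x : 'cV[R]_n => x i 0).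
Proof.
case: k => [|k]; first exact: coord_continuous.
split=> [x|v]; first exact: differentiable_coord.
rewrite (_ : 'D_v _ = fun=> v i 0); first exact: Ck_cst.
by apply/funext => x; rewrite derive_coord.
Qed.

(** [Ck] controls derivatives in fixed directions only, whereas the directions below, increments of
    X or columns of sigma(X), move with time. Linearity of the differential reduces them to the
    basis directions. *)
Lemma deriv_sum_coord f x v : differentiable f x ->
  'D_v f x = \sum_i v i 0 * 'D_(delta_mx i 0) f x.
Proof.
move=> df; rewrite deriveE//.
have {1}-> : v = \sum_i v i 0 *: delta_mx i 0.
  by rewrite [LHS]matrix_sum_delta; apply: eq_bigr => i _; rewrite big_ord1.
rewrite linear_sum; apply: eq_bigr => i _.
by rewrite linearZ/= deriveE.
Qed.

Lemma mean_value_segment f x h : (forall y, differentiable f y) ->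
  exists2 c, 0 <= c <= 1 & f (x + h) - f x = 'D_h f (x + c *: h).
Proof.
move=> df; pose g (c : R) := f (x + c *: h).
have dg (c : R) : is_derive c 1 g ('D_h f (x + c *: h)).
  have E : (fun e : R => e^-1 *: ((g \o shift c) (e *: 1) - g c)) =
      (fun e => e^-1 *: ((f \o shift (x + c *: h)) (e *: h) - f (x + c *: h))).
    apply/funext => e /=; rewrite /g; congr (_ *: (f _ - _)).
    by rewrite [_%:A]mulr1 scalerDl addrCA.
  have dfh : derivable f (x + c *: h) h by exact: diff_derivable.
  by apply: DeriveDef; rewrite /derivable /derive E.
have [|c + E] := @MVT_segment R g (fun c => 'D_h f (x + c *: h)) 0 1 ler01.
- by apply: derivable_within_continuous => c _; exact: ex_derive.
- rewrite in_itv/= => c01; exists c => //.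
  by move: E; rewrite subr0 mulr1 /g scale0r addr0 scale1r.
Qed.

(** Compactness of closed balls. The ball is taken among row vectors, where [bounded_closed_compact]
    applies, and transported by transposition, which does not increase the sup norm. *)
Lemma continuous_bounded_ball f r : continuous f ->
  exists2 M, 0 <= M & forall x, `|x| <= r -> `|f x| <= M.
Proof.
move=> cf; pose K := [set u : 'rV[R]_n | `|u| <= r].
have K_compact : compact K.
  apply: bounded_closed_compact.
    by exists r; split; [exact: num_real|move=> M rM u /le_trans; apply; exact: ltW].
  apply: (@preimage_closed _ _ (fun u : 'rV[R]_n => `|u|) [set z | z <= r]).
    by move=> u _; exact: norm_continuous.
  exact: closed_le.
have trC : continuous (@trmx R 1 n).
  move=> u /= B /nbhs_ballP[e e0 eB]; apply/nbhs_ballP; exists e => // u' uu'.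
  apply: eB; move: uu'; rewrite -!ball_normE /ball_/= => /(le_lt_trans _); apply.
  apply: mx_norm_le => // i j; rewrite !mxE.
  by have := ler_mx_norm_entry (u - u') j i; rewrite !mxE.
have cg : {within K, continuous (fun u : 'rV[R]_n => f u^T)}.
  apply: continuous_subspaceT => u; apply: continuous_comp; first exact: trC.
  exact: cf.
have /compact_bounded[M [_ HM]] := continuous_compact cg K_compact.
exists (`|M| + 1) => // x xr; apply: HM; first by rewrite ltr_pwDr// ler_norm.
exists x^T; last by rewrite trmxK.
rewrite /K/=; apply: le_trans xr; apply: mx_norm_le => // i j.
by rewrite mxE; exact: ler_mx_norm_entry.
Qed.

End Ck_vector_space.

(** * Lipschitz and Taylor estimates on balls *)

Section taylor.
Context {R : realType} {n : nat}.
Implicit Types (f : 'cV[R]_n -> R) (x y : 'cV[R]_n) (r : R).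

Lemma ler_norm_segment x y c r : `|x| <= r -> `|y| <= r -> 0 <= c <= 1 ->
  `|x + c *: (y - x)| <= r.
Proof.
move=> xr yr /andP[c0 c1].
have -> : x + c *: (y - x) = (1 - c) *: x + c *: y.
  by rewrite scalerBr scalerBl scale1r addrA addrAC.
apply: le_trans (ler_normD _ _) _; rewrite !normrZ !ger0_norm ?subr_ge0//.
have : (1 - c) * `|x| <= (1 - c) * r by rewrite ler_wpM2l// subr_ge0.
have : c * `|y| <= c * r by rewrite ler_wpM2l.
lra.
Qed.

Lemma Ck1_lipschitz_ball f r : Ck 1 f -> exists2 L, 0 <= L &
  forall x y, `|x| <= r -> `|y| <= r -> `|f y - f x| <= L * `|y - x|.
Proof.
move=> [df Df].
have bD i := continuous_bounded_ball r (Df (delta_mx i 0)).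
pose M i := sval (cid2 (bD i)).
have M0 i : 0 <= M i by rewrite /M; case: cid2.
have MP i x : `|x| <= r -> `|'D_(delta_mx i 0) f x| <= M i.
  by rewrite /M; case: cid2 => /= c _; apply.
exists (\sum_i M i); first exact: sumr_ge0.
move=> x y xr yr; have [c c01] := mean_value_segment x (y - x) df.
rewrite [x + (y - x)]addrC subrK => ->; rewrite deriv_sum_coord// mulr_suml.
apply: le_trans (ler_norm_sum _ _ _) _; apply: ler_sum => i _.
rewrite normrM mulrC; apply: ler_pM => //; last exact: ler_mx_norm_entry.
exact/MP/ler_norm_segment.
Qed.

(** The mean value theorem replaces the increment by a derivative at a point of the segment; its
    difference with the derivative at [x] is Lipschitz in each basis direction, which yields the
    square. *)
Lemma Ck2_taylor_ball f r : Ck 2 f -> exists2 L, 0 <= L &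
  forall x y, `|x| <= r -> `|y| <= r ->
    `|f y - f x - 'D_(y - x) f x| <= L * (`|y - x| * `|y - x|).
Proof.
move=> [df Df].
have bD i := Ck1_lipschitz_ball r (Df (delta_mx i 0)).
pose M i := sval (cid2 (bD i)).
have M0 i : 0 <= M i by rewrite /M; case: cid2.
have MP i x y : `|x| <= r -> `|y| <= r ->
    `|'D_(delta_mx i 0) f y - 'D_(delta_mx i 0) f x| <= M i * `|y - x|.
  by rewrite /M; case: cid2 => /= c _; apply.
exists (\sum_i M i); first exact: sumr_ge0.
move=> x y xr yr; have [c c01] := mean_value_segment x (y - x) df.
rewrite [x + (y - x)]addrC subrK => ->; rewrite !(deriv_sum_coord (y - x))// -sumrB mulr_suml.
apply: le_trans (ler_norm_sum _ _ _) _; apply: ler_sum => i _.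
rewrite -mulrBr normrM mulrC mulrA; apply: ler_pM => //; last first.
  exact: ler_mx_norm_entry.
apply: le_trans (MP _ _ _ xr (ler_norm_segment xr yr c01)) _.
rewrite addrAC subrr add0r normrZ ler_wpM2l//; case/andP: c01 => c0 c1.
by rewrite ger0_norm// -[leRHS]mul1r ler_wpM2r.
Qed.

End taylor.

(** * Functions of a controlled path and their rough germs *)

Section composition.
Context {R : realType} {n : nat}.
Variables (T alpha : R) (X : R -> 'cV[R]_n).
Hypothesis X_bounded : exists r, forall s, 0 <= s -> s <= T -> `|X s| <= r.
Hypothesis X_holder : is_O T alpha (incr X).
Implicit Types phi : 'cV[R]_n -> R.

Lemma bounded_path_comp phi : continuous phi -> bounded_path T (fun s => phi (X s)).
Proof.
move=> cphi; have [r Xr] := X_bounded.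
have [M M0 HM] := continuous_bounded_ball r cphi.
by exists M => // s s0 sT; apply/HM/Xr.
Qed.

Lemma is_O_incr_comp phi : Ck 1 phi -> is_O T alpha (incr (fun s => phi (X s))).
Proof.
move=> Cphi; have [r Xr] := X_bounded.
have [L L0 HL] := Ck1_lipschitz_ball r Cphi; have [C C0 HC] := X_holder.
exists (L * C); first exact: mulr_ge0.
move=> s t s0 st tT; apply: le_trans (HL _ _ _ _) _.
- by apply: Xr => //; exact: le_trans (ltW st) tT.
- by apply: Xr => //; exact: le_trans (ltW st).
- by rewrite -mulrA ler_wpM2l//; exact: HC.
Qed.

Lemma is_O_taylor_comp phi : Ck 2 phi ->
  is_O T (2 * alpha) (fun s t =>
    phi (X t) - phi (X s) - 'D_(incr X s t) phi (X s)).
Proof.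
move=> Cphi; have [r Xr] := X_bounded.
have [L L0 HL] := Ck2_taylor_ball r Cphi; have [C C0 HC] := X_holder.
exists (L * (C * C)); first by rewrite !mulr_ge0.
move=> s t s0 st tT; apply: le_trans (HL _ _ _ _) _.
- by apply: Xr => //; exact: le_trans (ltW st) tT.
- by apply: Xr => //; exact: le_trans (ltW st).
- rewrite -mulrA ler_wpM2l// mulrDl mul1r powRD.
    by rewrite mulrACA; apply: ler_pM => //; exact: HC.
  by rewrite [t - s == 0]gt_eqF ?implybT// subr_gt0.
Qed.

Variables (d : nat) (W : R -> 'cV[R]_d) (X' : R -> 'M[R]_(n, d)).
Hypothesis X_controlled :
  is_O T (2 * alpha) (fun s t => incr X s t - X' s *m incr W s t).

(** Chain rule for controlled paths: the remainder is the Taylor remainder of phi plus Dphi(X_s)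
    applied to the remainder of X. *)
Lemma is_O_controlled_comp phi : Ck 2 phi ->
  is_O T (2 * alpha) (fun s t => incr (fun r => phi (X r)) s t -
    \sum_a incr W s t a 0 * 'D_(col a (X' s)) phi (X s)).
Proof.
move=> Cphi; have [dphi Dphi] := Cphi.
apply: (@eq_is_O _ _ _ _ (fun s t =>
  (phi (X t) - phi (X s) - 'D_(incr X s t) phi (X s)) +
  \sum_i 'D_(delta_mx i 0) phi (X s) * (incr X s t - X' s *m incr W s t) i 0)).
  move=> s t _ _ _; rewrite /incr -addrA; congr (_ + _).
  rewrite (deriv_sum_coord (X t - X s))// addrC -sumrB.
  rewrite (eq_bigr (fun a => \sum_i (W t - W s) a 0 *
      (X' s i a * 'D_(delta_mx i 0) phi (X s)))); last first.
    move=> a _; rewrite deriv_sum_coord// mulr_sumr; apply: eq_bigr => i _.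
    by rewrite [col _ _ _ _]mxE.
  rewrite exchange_big -sumrN; apply: eq_bigr => i _.
  rewrite [(X t - X s - _) i 0]mxE [(- (X' s *m _)) i 0]mxE [(X' s *m _) _ _]mxE /=.
  rewrite mulrDr mulrN mulr_sumr [_ * (X t - X s) i 0]mulrC addrAC subrr add0r.
  by congr (- _); apply: eq_bigr => a _; ring.
apply: is_OD; first exact: is_O_taylor_comp.
apply: is_O_sum => i; apply: is_OMl; last exact: is_O_entry X_controlled.
exact: bounded_path_comp (@CkS_Ck _ _ _ 0 _ (Dphi _)).
Qed.

Hypothesis X'_bounded : forall i a, bounded_path T (fun s => X' s i a).
Hypothesis X'_holder : is_O T alpha (incr X').

(** Expanded over the basis directions, the path is a sum of products of bounded alpha-Hölder
    paths. *)
Lemma is_O_incr_comp_deriv phi a : Ck 2 phi ->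
  is_O T alpha (incr (fun s => 'D_(col a (X' s)) phi (X s))).
Proof.
move=> [dphi Dphi].
have -> : (fun s => 'D_(col a (X' s)) phi (X s)) =
    (fun s => \sum_i X' s i a * 'D_(delta_mx i 0) phi (X s)).
  apply/funext => s; rewrite deriv_sum_coord//.
  by apply: eq_bigr => i _; rewrite mxE.
apply: is_O_incr_sum => i; apply: is_O_incrM => //.
- exact: bounded_path_comp (@CkS_Ck _ _ _ 0 _ (Dphi _)).
- apply: eq_is_O (is_O_entry i a X'_holder) => s t _ _ _.
  by rewrite /incr !mxE.
- exact: is_O_incr_comp (Dphi _).
Qed.

Variable WW : R -> R -> 'M[R]_d.
Hypothesis WW_chen : forall s u t, 0 <= s -> s <= u -> u <= t -> t <= T ->
  WW s t - WW s u - WW u t = tens (incr W s u) (incr W u t).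
Hypothesis W_holder : is_O T alpha (incr W).
Hypothesis WW_holder : is_O T (2 * alpha) WW.
Hypothesis alpha_gt : 3^-1 < alpha.

Lemma rough_diag s : 0 <= s -> s <= T -> WW s s = 0.
Proof.
move=> s0 sT; have := WW_chen s0 (lexx s) (lexx s) sT.
rewrite /tens /incr !subrr mul0mx sub0r => /eqP.
by rewrite oppr_eq0 => /eqP.
Qed.

(** By Chen's relation the defect of the germ is, summed over the indices, minus the remainder of Y
    over [s, u] times W_{u,t}, minus the increment of Y' over [s, u] times WW_{u,t}. The orders are
    2 alpha + alpha and alpha + 2 alpha, both above 1 in total. *)
Lemma scalar_rough_sewing (phi : 'I_d -> 'cV[R]_n -> R) :
  (forall k, Ck 2 (phi k)) ->
  exists2 I : R -> R -> R, additive_on T I &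
  is_O T (3 * alpha) (fun s t => I s t -
    (\sum_k incr W s t k 0 * phi k (X s) +
     \sum_a \sum_k WW s t a k * 'D_(col a (X' s)) (phi k) (X s))).
Proof.
move=> Cphi.
pose Y k s := phi k (X s).
pose Y' a k s := 'D_(col a (X' s)) (phi k) (X s).
pose A s t := \sum_k incr W s t k 0 * Y k s + \sum_a \sum_k WW s t a k * Y' a k s.
have alpha0 : 0 <= alpha by apply: le_trans (ltW alpha_gt); rewrite invr_ge0.
have A_diag s : 0 <= s -> s <= T -> A s s = 0.
  move=> s0 sT; rewrite /A big1 ?add0r => [|k _].
    by rewrite big1// => a _; rewrite big1// => k _; rewrite rough_diag// mxE mul0r.
  by rewrite /incr subrr mxE mul0r.
have [C C0 AC] : is_O3 T (3 * alpha) (fun s u t => A s t - A s u - A u t).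
  apply: (@eq_is_O3 _ _ _ _ (fun s u t => \sum_k
     (- ((incr (Y k) s u - \sum_a incr W s u a 0 * Y' a k s) * incr W u t k 0) +
      \sum_a - (incr (Y' a k) s u * WW u t a k)))).
    move=> s u t s0 su ut tT.
    have AE v v' : A v v' =
        \sum_k (incr W v v' k 0 * Y k v + \sum_a WW v v' a k * Y' a k v).
      by rewrite /A exchange_big -big_split.
    rewrite !AE -!sumrB; apply: eq_bigr => k _.
    have chen a : WW s t a k = WW s u a k + WW u t a k + incr W s u a 0 * incr W u t k 0.
      have /(congr1 (fun M : 'M[R]_d => M a k)) := WW_chen s0 (ltW su) (ltW ut) tT.
      rewrite /tens !mxE big_ord1 !mxE => E.
      have -> : WW s t a k = (WW s t a k - WW s u a k - WW u t a k) + (WW s u a k + WW u t a k).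
        by ring.
      by rewrite E /incr ?mxE; ring.
    have -> : \sum_a WW s t a k * Y' a k s =
        \sum_a WW s u a k * Y' a k s + \sum_a WW u t a k * Y' a k s +
        (\sum_a incr W s u a 0 * Y' a k s) * incr W u t k 0.
      rewrite mulr_suml -!big_split; apply: eq_bigr => a _ /=.
      by rewrite chen; ring.
    have -> : \sum_a - (incr (Y' a k) s u * WW u t a k) =
        \sum_a WW u t a k * Y' a k s - \sum_a WW u t a k * Y' a k u.
      by rewrite -sumrB; apply: eq_bigr => a _; rewrite /incr; ring.
    have -> : incr W s t k 0 = incr W s u k 0 + incr W u t k 0.
      by rewrite /incr !mxE; ring.
    by rewrite /incr; ring.
  apply: is_O3_sum => k; apply: is_O3D.
    apply: is_O3N; have -> : 3 * alpha = 2 * alpha + alpha by ring.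
    apply: (is_O3M (A := fun s u => _) (B := fun u t => incr W u t k 0)) => //.
    - by rewrite mulr_ge0.
    - exact: is_O_controlled_comp.
    - exact: is_O_entry W_holder.
  apply: is_O3_sum => a; apply: is_O3N.
  have -> : 3 * alpha = alpha + 2 * alpha by ring.
  apply: (is_O3M (B := fun u t => WW u t a k)) => //.
  - by rewrite mulr_ge0.
  - exact: is_O_incr_comp_deriv.
  - exact: is_O_entry WW_holder.
apply: (@sewing R R T (3 * alpha) C A) => //; first by have := alpha_gt; lra.
(* [sewing] also asks about degenerate triples, which [is_O3] excludes; there the defect vanishes
   since the germ is zero on the diagonal. *)
move=> s u t s0 su ut tT.
have bnd0 : 0 <= C * (t - s) `^ (3 * alpha) by rewrite mulr_ge0// powR_ge0.
have [su'|su'] := eqVneq s u.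
  by rewrite su' A_diag -?su' ?(le_trans su (le_trans ut tT))// subr0 subrr normr0.
have [ut'|ut'] := eqVneq u t.
  rewrite -ut' A_diag ?(le_trans s0 su) ?(le_trans ut tT)// subrr subr0 normr0.
  by rewrite ut'.
by apply: AC => //; rewrite lt_neqAle ?su' ?ut'.
Qed.

End composition.

(** * Rough and Lebesgue integrals *)

Section rough_integral_theory.
Context {R : realType}.

(** The summand of [rough_sum] as a two-parameter map, so that [rough_sum] is by conversion a
    [partition_sum]. *)
Definition rough_germ d (V : normedModType R)
    (W : R -> 'cV[R]_d) (WW : R -> R -> 'M[R]_d)
    (Y : R -> 'I_d -> V) (Y' : R -> 'I_d -> 'I_d -> V) (s t : R) : V :=
  \sum_k incr W s t k 0 *: Y s k + \sum_a \sum_k WW s t a k *: Y' s a k.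

(** Serves both for maps produced by sewing and for an explicit candidate; existence of the limit
    comes along with its value. *)
Lemma rough_integral_unique d (V : normedModType R) (T theta : R)
    (W : R -> 'cV[R]_d) (WW : R -> R -> 'M[R]_d)
    (Y : R -> 'I_d -> V) (Y' : R -> 'I_d -> 'I_d -> V) (I : R -> R -> V) s t :
  1 < theta -> additive_on T I ->
  is_O T theta (fun s t => I s t - rough_germ W WW Y Y' s t) ->
  0 <= s -> s <= t -> t <= T ->
  rough_integrable W WW Y Y' s t /\ rough_integral W WW Y Y' s t = I s t.
Proof.
move=> th1 addI OI s0 st tT.
have := partition_sum_cvg th1 addI OI s0 tT.
rewrite -[partition_sum _ s]/(rough_sum W WW Y Y' s) => cv.
have PF := mesh_to0_proper st.
split; first by apply: cvgP cv.
by rewrite /rough_integral /oriented st; apply: cvg_lim => //; exact: norm_hausdorff.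
Qed.

Lemma comp_deriv_entry d n p q (Phi : 'cV[R]_n -> 'I_d -> 'M[R]_(p, q))
    (X : R -> 'cV[R]_n) (X' : R -> 'M[R]_(n, d)) r a k i j :
  (forall i j x, differentiable (fun x => Phi x k i j) x) ->
  comp_deriv Phi X X' r a k i j =
  'D_(col a (X' r)) (fun x => Phi x k i j) (X r).
Proof.
move=> dPhi; rewrite /comp_deriv derive_mx ?mxE//.
by apply/derivable_mxP => i' j'; exact/diff_derivable/dPhi.
Qed.

Lemma rough_germ_entry d n p q (W : R -> 'cV[R]_d) (WW : R -> R -> 'M[R]_d)
    (Phi : 'cV[R]_n -> 'I_d -> 'M[R]_(p, q))
    (X : R -> 'cV[R]_n) (X' : R -> 'M[R]_(n, d)) s t i j :
  (forall k i j x, differentiable (fun x => Phi x k i j) x) ->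
  rough_germ W WW (comp_path Phi X) (comp_deriv Phi X X') s t i j =
  \sum_k incr W s t k 0 * Phi (X s) k i j +
  \sum_a \sum_k WW s t a k * 'D_(col a (X' s)) (fun x => Phi x k i j) (X s).
Proof.
move=> dPhi; rewrite /rough_germ mxE !summxE; congr (_ + _).
  by apply: eq_bigr => k _; rewrite mxE.
apply: eq_bigr => a _; rewrite summxE; apply: eq_bigr => k _.
by rewrite mxE comp_deriv_entry.
Qed.

Lemma matrix_rough_sewing d n p q (T alpha : R)
    (W : R -> 'cV[R]_d) (WW : R -> R -> 'M[R]_d)
    (X : R -> 'cV[R]_n) (X' : R -> 'M[R]_(n, d))
    (Phi : 'cV[R]_n -> 'I_d -> 'M[R]_(p, q)) :
  3^-1 < alpha ->
  (forall s u t, 0 <= s -> s <= u -> u <= t -> t <= T ->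
    WW s t - WW s u - WW u t = tens (incr W s u) (incr W u t)) ->
  is_O T alpha (incr W) -> is_O T (2 * alpha) WW ->
  (exists r, forall s, 0 <= s -> s <= T -> `|X s| <= r) ->
  (forall i a, bounded_path T (fun s => X' s i a)) ->
  is_O T alpha (incr X) -> is_O T alpha (incr X') ->
  is_O T (2 * alpha) (fun s t => incr X s t - X' s *m incr W s t) ->
  (forall k i j, Ck 2 (fun x => Phi x k i j)) ->
  exists2 I : R -> R -> 'M[R]_(p, q), additive_on T I &
  is_O T (3 * alpha) (fun s t => I s t -
    rough_germ W WW (comp_path Phi X) (comp_deriv Phi X X') s t).
Proof.
move=> a3 chen OW OWW bX bX' OX OX' OR CPhi.
have H i j := scalar_rough_sewing bX OX OR bX' OX' chen OW OWW a3
  (phi := fun k x => Phi x k i j) (fun k => CPhi k i j).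
pose I i j := sval (cid2 (H i j)).
exists (fun s t => \matrix_(i, j) I i j s t).
  move=> s u t s0 su ut tT; apply/matrixP => i j; rewrite !mxE /I.
  by case: cid2 => /= J addJ _; exact: addJ.
apply: is_O_mx => i j.
have : is_O T (3 * alpha) (fun s t => I i j s t -
    (\sum_k incr W s t k 0 * Phi (X s) k i j +
     \sum_a \sum_k WW s t a k * 'D_(col a (X' s)) (fun x => Phi x k i j) (X s))).
  by rewrite /I; case: cid2.
apply: eq_is_O => s t _ _ _; rewrite 3!mxE rough_germ_entry// => k i' j'.
by have [] := CPhi k i' j'.
Qed.

End rough_integral_theory.

(** * The drift: Lebesgue integrals along the path *)

Section lebesgue_part.
Context {R : realType}.
Variable T : R.
Implicit Types (g h : R -> R) (s t : R).
Local Notation mu := (@lebesgue_measure R).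

Lemma is_O_incr_bounded (V : normedModType R) alpha (X : R -> V) :
  0 < T -> 0 <= alpha -> is_O T alpha (incr X) ->
  exists2 r, 0 <= r & forall s, 0 <= s -> s <= T -> `|X s| <= r.
Proof.
move=> T0 a0 [C C0 CX]; exists (`|X 0| + C * T `^ alpha).
  by rewrite addr_ge0// mulr_ge0// powR_ge0.
move=> s; rewrite le_eqVlt => /predU1P[<- _|s0 sT].
  by rewrite lerDl mulr_ge0// powR_ge0.
have -> : X s = X 0 + incr X 0 s by rewrite /incr addrC subrK.
apply: le_trans (ler_normD _ _) _; rewrite lerD2l.
apply: le_trans (CX _ _ (lexx 0) s0 sT) _; rewrite subr0 ler_wpM2l//.
by apply: ge0_ler_powR; rewrite ?nnegrE// ltW.
Qed.

Lemma is_O_incr_within_continuous (V : normedModType R) alpha (X : R -> V) :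
  0 < alpha -> is_O T alpha (incr X) -> {within `[0, T], continuous X}.
Proof.
move=> a0 [C C0 CX]; apply/subspace_continuousP => x /=.
rewrite in_itv/= => /andP[x0 xT]; apply/cvgrPdist_lt => e e0.
have [||d d0 dlt] := @exists_powR_lt R alpha (e / (C + 1)).
- by [].
- by rewrite divr_gt0// ltr_wpDl.
rewrite ltr_pdivlMr ?ltr_wpDl// in dlt.
have Cd : C * d `^ alpha < e.
  by apply: le_lt_trans dlt; rewrite mulrC mulrDr mulr1 lerDl powR_ge0.
exists d => //= y; rewrite /ball_ /= => xy; rewrite in_itv/= => /andP[y0 yT].
have bnd u v : 0 <= u -> u < v -> v <= T -> v - u < d -> `|X u - X v| < e.
  move=> u0 uv vT vud; rewrite distrC; apply: le_lt_trans Cd.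
  apply: le_trans (CX _ _ u0 uv vT) _; rewrite ler_wpM2l//.
  by apply: ge0_ler_powR; rewrite ?nnegrE ?subr_ge0 ?(ltW uv) ?(ltW a0) ?(ltW d0) ?(ltW vud).
have [xy'|yx|->] := ltgtP x y.
- by apply: bnd => //; move: xy; rewrite distrC gtr0_norm ?subr_gt0.
- by rewrite distrC; apply: bnd => //; move: xy; rewrite gtr0_norm ?subr_gt0.
- by rewrite subrr normr0.
Qed.

Lemma integrable_subitv g s t : {within `[0, T], continuous g} ->
  0 <= s -> t <= T -> mu.-integrable `[s, t] (EFin \o g).
Proof.
move=> cg s0 tT.
have /integrableS : mu.-integrable `[0, T] (EFin \o g).
  by apply: continuous_compact_integrable => //; exact: segment_compact.
by apply => //; apply: subset_itv; rewrite bnd_simp.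
Qed.

(** The closed intervals [s, u] and [u, t] overlap in [u] alone, a null set, so the second may be
    taken half-open. *)
Lemma Rintegral_additive g : {within `[0, T], continuous g} ->
  additive_on T (fun s t => Rintegral mu `[s, t] g).
Proof.
move=> cg s u t s0 su ut tT.
have ig := integrable_subitv cg s0 tT.
rewrite -(@Rintegral_itv_obnd_cbnd _ u).
  by rewrite -(Rintegral_itvB ig) ?bnd_simp// addrC subrK.
apply: integrableS (integrable_subitv cg (le_trans s0 su) tT) => //.
by apply: subset_itv; rewrite bnd_simp.
Qed.

Lemma normr_Rintegral_le g s t (M : R) : {within `[0, T], continuous g} ->
  0 <= s -> s <= t -> t <= T ->
  (forall r, s <= r -> r <= t -> `|g r| <= M) ->
  `|Rintegral mu `[s, t] g| <= M * (t - s).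
Proof.
move=> cg s0 st tT gM; have ig := integrable_subitv cg s0 tT.
apply: le_trans (le_normr_Rintegral _ ig) _ => //.
have -> : M * (t - s) = Rintegral mu `[s, t] (cst M).
  rewrite Rintegral_cst//= lebesgue_measure_itv/= lte_fin.
  by case: ltgtP st => // -> _; rewrite subrr.
apply: le_Rintegral => //.
- exact: integrable_norm ig.
- apply: (@integrable_subitv (cst M)) => //.
  by apply: continuous_subspaceT => x; exact: cvg_cst.
- by move=> r /=; rewrite in_itv/= => /andP[]; exact: gM.
Qed.

(** The integrand is of order alpha, and the length of the interval contributes the additional 1. *)
Lemma is_O_Rintegral_incr alpha g h : 0 < alpha ->
  is_O T alpha (incr g) -> {within `[0, T], continuous h} -> bounded_path T h ->
  is_O T (1 + alpha)
    (fun s t => Rintegral mu `[s, t] (fun r => (g r - g s) * h r)).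
Proof.
move=> a0 Og ch [M M0 hM].
have cg := is_O_incr_within_continuous a0 Og.
have [C C0 gC] := Og.
exists (C * M); first exact: mulr_ge0.
move=> s t s0 st tT; have ts : 0 < t - s by rewrite subr_gt0.
rewrite powRD; last by rewrite [t - s == 0]gt_eqF// implybT.
rewrite powRr1 ?(ltW ts)// [(t - s) * _]mulrC mulrA.
apply: normr_Rintegral_le => //; [|exact: ltW|].
  move=> r; apply: cvgM; last exact: ch.
  by apply: cvgB; [exact: cg|exact: cvg_cst].
move=> r sr rt; rewrite normrM mulrAC; apply: ler_pM => //; last first.
  by apply: hM; [exact: le_trans sr|exact: le_trans tT].
move: sr; rewrite le_eqVlt => /predU1P[<-|sr].
  by rewrite subrr normr0 mulr_ge0// powR_ge0.
apply: le_trans (gC _ _ s0 sr (le_trans rt tT)) _; rewrite ler_wpM2l//.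
by apply: ge0_ler_powR; rewrite ?nnegrE ?subr_ge0 ?(ltW sr) ?(ltW st) ?(ltW a0)// lerD2r.
Qed.

Lemma within_continuous_sum n (g : 'I_n -> R -> R) :
  (forall i, {within `[0, T], continuous (g i)}) ->
  {within `[0, T], continuous (fun r => \sum_i g i r)}.
Proof.
elim: n g => [g _|n IH g cg].
  rewrite (_ : (fun _ => _) = cst 0); last by apply/funext => r; rewrite big_ord0.
  by apply: continuous_subspaceT => x; exact: cvg_cst.
rewrite (_ : (fun _ => _) = fun r => g ord0 r + \sum_i g (lift ord0 i) r).
  move=> r; apply: cvgD; [exact: cg|].
  exact: (IH (fun i => g (lift ord0 i)) (fun i => cg _) r).
by apply/funext => r; rewrite big_ord_recl.
Qed.

Lemma Rintegral_sum n (g : 'I_n -> R -> R) s t :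
  (forall i, {within `[0, T], continuous (g i)}) -> 0 <= s -> t <= T ->
  Rintegral mu `[s, t] (fun r => \sum_i g i r) =
  \sum_i Rintegral mu `[s, t] (g i).
Proof.
move=> + s0 tT; elim: n g => [g _|n IH g cg].
  rewrite big_ord0 (_ : (fun _ => _) = cst 0).
    by rewrite Rintegral_cst// mul0r.
  by apply/funext => r; rewrite big_ord0.
rewrite big_ord_recl -(IH (fun i => g (lift ord0 i)))// -RintegralD//.
- by apply: eq_Rintegral => r _; rewrite big_ord_recl.
- exact: integrable_subitv.
- by apply: integrable_subitv => //; exact: within_continuous_sum.
Qed.

Lemma mxintE m n (g : R -> 'M[R]_(m, n)) s t i j : s <= t ->
  mxint g s t i j = Rintegral mu `[s, t] (fun r => g r i j).
Proof. by move=> st; rewrite /mxint /oriented st mxE. Qed.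

Lemma mxint_additive m n (g : R -> 'M[R]_(m, n)) :
  (forall i j, {within `[0, T], continuous (fun r => g r i j)}) ->
  additive_on T (mxint g).
Proof.
move=> cg s u t s0 su ut tT; apply/matrixP => i j.
rewrite mxE !mxintE//; last exact: le_trans ut.
exact: (Rintegral_additive (cg i j)).
Qed.

End lebesgue_part.

(** * Comparison of the germs and the change of driver *)

Lemma mx_subE (K : zmodType) m n (M N : 'M[K]_(m, n)) i j :
  (M - N) i j = M i j - N i j.
Proof. by rewrite !mxE. Qed.

(* With [S], [DS] the values of sigma and of its derivatives along the columns
   of sigma, [G] and [E] are the local expansions of the integrals of sigma(X)
   and eta(X) over [s, t], so that [E a k - x a * G k] is that of the (a, k)
   entry of the lift of X; the left-hand side is the local expansion of the
   integral of (F sigma)(X). *)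
Lemma rough_germ_identity (K : comNzRingType) d (w x F : 'I_d -> K)
    (ww S DF : 'I_d -> 'I_d -> K) (DS : 'I_d -> 'I_d -> 'I_d -> K) :
  let G k := \sum_l w l * S k l + \sum_b \sum_l ww b l * DS b k l in
  let E a k := \sum_l w l * (x a * S k l) +
    \sum_b \sum_l ww b l * (x a * DS b k l + S k l * S a b) in
  \sum_l w l * (\sum_k F k * S k l) +
  \sum_b \sum_l ww b l *
    (\sum_k (F k * DS b k l + S k l * \sum_a S a b * DF a k)) =
  \sum_k G k * F k + \sum_a \sum_k (E a k - x a * G k) * DF a k.
Proof.
move=> G E.
(* All terms carrying [x a] cancel; what is left is the (a, k) entry of S ww S^T. *)
have EG a k : E a k - x a * G k = \sum_b \sum_l ww b l * (S k l * S a b).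
  rewrite /E /G mulrDr !mulr_sumr opprD addrACA -sumrB big1 ?add0r; last first.
    by move=> l _; ring.
  rewrite -sumrB; apply: eq_bigr => b _.
  by rewrite mulr_sumr -sumrB; apply: eq_bigr => l _; ring.
under [X in _ = _ + X]eq_bigr => a _ do under eq_bigr => k _ do rewrite EG.
rewrite /G; under [X in _ = X + _]eq_bigr => k _ do rewrite mulrDl.
rewrite [X in _ = X + _]big_split/= -addrA; congr (_ + _).
  under eq_bigr => l _ do rewrite mulr_sumr.
  rewrite exchange_big; apply: eq_bigr => k _; rewrite mulr_suml.
  by apply: eq_bigr => l _; ring.
rewrite [X in _ = _ + X]exchange_big -big_split/=.
have -> : \sum_b \sum_l ww b l *
    (\sum_k (F k * DS b k l + S k l * \sum_a S a b * DF a k)) =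
    \sum_k \sum_b \sum_l ww b l *
      (F k * DS b k l + S k l * \sum_a S a b * DF a k).
  rewrite [RHS]exchange_big; apply: eq_bigr => b _.
  rewrite [RHS]exchange_big; apply: eq_bigr => l _.
  by rewrite mulr_sumr.
apply: eq_bigr => k _.
have -> : \sum_a (\sum_b \sum_l ww b l * (S k l * S a b)) * DF a k =
    \sum_b \sum_l ww b l * (S k l * \sum_a S a b * DF a k).
  under eq_bigr => a _ do rewrite mulr_suml.
  rewrite exchange_big; apply: eq_bigr => b _.
  under eq_bigr => a _ do rewrite mulr_suml.
  rewrite exchange_big; apply: eq_bigr => l _.
  by rewrite [RHS]mulrA mulr_sumr; apply: eq_bigr => a _; ring.
rewrite mulr_suml -big_split; apply: eq_bigr => b _ /=.
by rewrite mulr_suml -big_split; apply: eq_bigr => l _ /=; ring.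
Qed.

Theorem lemma2p5 (R : realType) (d : nat) (T H alpha : R) (x0 : 'cV[R]_d)
    (disp : measure_display) (Omega : measurableType disp)
    (P : probability Omega R)
    (B : Omega -> R -> 'cV[R]_d) (BB : Omega -> R -> R -> 'M[R]_d)
    (w : Omega)
    (f : 'cV[R]_d -> 'cV[R]_d) (sigma F : 'cV[R]_d -> 'M[R]_d)
    (X : R -> 'cV[R]_d) (XX : R -> R -> 'M[R]_d)
    (d_ge1 : (1 <= d)%N) (T_gt0 : 0 < T)
    (H_range : 3^-1 < H <= 2^-1) (alpha_range : 3^-1 < alpha < H)
    (B_fbm : fbm_lift P H alpha T B BB)
    (B_w : geometric_rough_path alpha T (B w) (BB w))
    (F1 : bounded_map f /\ continuous f)
    (S1 : [/\ Ck 2 sigma, bounded_map sigma, bounded_D sigma &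
              bounded_D2 sigma])
    (S2 : exists2 lambda : R, 0 < lambda &
            forall v x : 'cV[R]_d,
              `|dotv v (sigma x *m v)| >= lambda * dotv v v)
    (S3 : conservative (fun x => invmx (sigma x)))
    (X_sol : rde_solution alpha T (B w) (BB w) x0 f sigma
               X (fun t => sigma (X t)))
    (XX_def : forall s t, s \in `[0, T] -> t \in `[0, T] ->
                XX s t = solution_lift (B w) (BB w) f sigma X s t)
    (XX_geom : geometric_rough_path alpha T X XX)
    (F_C2 : Ck 2 F) :
  [/\ rough_integrable_comp X XX (fun x => cols (F x)) X (fun=> 1%:M) 0 T,
      rough_integrable_comp (B w) (BB w) (fun x => cols (F x *m sigma x)) X
        (fun t => sigma (X t)) 0 T &
      rough_integral_comp X XX (fun x => cols (F x)) X (fun=> 1%:M) 0 T =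
      mxint (fun r => F (X r) *m f (X r)) 0 T +
      rough_integral_comp (B w) (BB w) (fun x => cols (F x *m sigma x)) X
        (fun t => sigma (X t)) 0 T].
Proof.
have [[chen0 /holder2_is_O OW /holder2_is_O OWW] _] := B_w.
have [[/holder2_is_O OX /holder2_is_O OX' /holder2_is_O OR] X_eq] := X_sol.
have [_ f_cont] := F1; have [sigma_C2 _ _ _] := S1.
(* From here on the argument is deterministic, for the fixed realization. *)
move: (B w) (BB w) => W WW in B_w X_sol XX_def chen0 OW OWW OR X_eq *.
have /andP[a3 aH] := alpha_range; have /andP[_ H2] := H_range.
have a0 : 0 < alpha by apply: lt_trans a3; rewrite invr_gt0.
have th1 : 1 < 3 * alpha by lra.
have inT s : 0 <= s -> s <= T -> s \in `[0, T] by move=> *; rewrite in_itv/=; apply/andP.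
have chen s u t : 0 <= s -> s <= u -> u <= t -> t <= T ->
    WW s t - WW s u - WW u t = tens (incr W s u) (incr W u t).
  move=> s0 su ut tT; apply: chen0; apply: inT => //.
  - exact: le_trans su (le_trans ut tT).
  - exact: le_trans su.
  - exact: le_trans ut tT.
  - exact: le_trans s0 (le_trans su ut).
have bX : exists r, forall s, 0 <= s -> s <= T -> `|X s| <= r.
  by have [r _ Xr] := is_O_incr_bounded T_gt0 (ltW a0) OX; exists r.
have bX' i a : bounded_path T (fun s => sigma (X s) i a).
  have [r r0 Xr] := is_O_incr_bounded T_gt0 (ltW a0) OX'.
  exists r => // s s0 sT; apply: le_trans (Xr s s0 sT).
  exact: (ler_mx_norm_entry (sigma (X s))).
have C_sigma i k : Ck 2 (fun x => sigma x i k) by exact: Ck_entry.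
have C_F i k : Ck 2 (fun x => F x i k) by exact: Ck_entry.
have d_sigma i k x : differentiable (fun x => sigma x i k) x by have [] := C_sigma i k.
have d_F i k x : differentiable (fun x => F x i k) x by have [] := C_F i k.
have C_cols_sigma k i j : Ck 2 (fun x => cols (sigma x) k i j).
  by rewrite (_ : (fun _ => _) = fun x => sigma x i k)//; apply/funext => x; rewrite mxE.
have C_cols_F k i j : Ck 2 (fun x => cols (F x) k i j).
  by rewrite (_ : (fun _ => _) = fun x => F x i k)//; apply/funext => x; rewrite mxE.
have etaE k i j : (fun x => Defs.eta sigma x k i j) = (fun x => x i 0 * sigma x j k).
  by apply/funext => x; rewrite /Defs.eta /tens mxE big_ord1 !mxE.
have C_eta k i j : Ck 2 (fun x => Defs.eta sigma x k i j).
  by rewrite etaE; apply: CkM; [exact: Ck_coord|].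
have FsE k i j : (fun x => cols (F x *m sigma x) k i j) =
    (fun x => \sum_l F x i l * sigma x l k).
  by apply/funext => x; rewrite !mxE.
have C_Fs k i j : Ck 2 (fun x => cols (F x *m sigma x) k i j).
  by rewrite FsE; apply: Ck_sum => l; exact: CkM.
have sew p q (Phi : 'cV[R]_d -> 'I_d -> 'M[R]_(p, q)) :=
  matrix_rough_sewing (Phi := Phi) a3 chen OW OWW bX bX' OX OX' OR.
have [Is addIs OIs] := sew _ _ _ C_cols_sigma.
have [Ie addIe OIe] := sew _ _ _ C_eta.
have [Ifs addIfs OIfs] := sew _ _ _ C_Fs.
(* Identifies the maps obtained by sewing with the rough integrals in the equation and in the
   lift. *)
have IsE s t s0 st tT := proj2 (rough_integral_unique th1 addIs OIs (s := s) (t := t) s0 st tT).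
have IeE s t s0 st tT := proj2 (rough_integral_unique th1 addIe OIe (s := s) (t := t) s0 st tT).
have [int_fs IfsE] := rough_integral_unique th1 addIfs OIfs (lexx 0) (ltW T_gt0) (lexx T).
have cX := is_O_incr_within_continuous a0 OX.
have c_comp (phi : 'cV[R]_d -> R) : continuous phi ->
    {within `[0, T], continuous (fun r => phi (X r))}.
  by move=> cphi r; exact: (continuous_comp (cX r) (cphi (X r))).
have cf k : continuous (fun x => f x k 0).
  move=> x; apply: (@continuous_comp _ _ _ f (fun A : 'cV[R]_d => A k 0)).
    exact: f_cont.
  exact: coord_continuous.
have cfX k j : {within `[0, T], continuous (fun r => f (X r) k j)}.
  by rewrite ord1; exact: (c_comp _ (cf k)).
have cF i k : continuous (fun x => F x i k).
  by move=> x; exact: differentiable_continuous (d_F i k x).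
have cFf i j : {within `[0, T], continuous (fun r => (F (X r) *m f (X r)) i j)}.
  rewrite ord1 (_ : (fun _ => _) = fun r => \sum_k F (X r) i k * f (X r) k 0).
    apply: within_continuous_sum => k r.
    by apply: cvgM; [exact: (c_comp _ (cF i k))|exact: (c_comp _ (cf k))].
  by apply/funext => r; rewrite mxE.
have add_f : additive_on T (mxint (fun r => f (X r))) by exact: mxint_additive.
have add_Ff : additive_on T (mxint (fun r => F (X r) *m f (X r))).
  exact: mxint_additive.
(* The equation starts at time 0; additivity of both integrals turns it into one for increments. *)
have incrX s t : 0 <= s -> s <= t -> t <= T ->
    incr X s t = mxint (fun r => f (X r)) s t + Is s t.
  move=> s0 st tT; have t0 := le_trans s0 st; have sT := le_trans st tT.
  have Is0 v : 0 <= v -> v <= T -> X v = x0 + mxint (fun r => f (X r)) 0 v + Is 0 v.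
    move=> v0 vT; have [-> _] := X_eq v (inT _ v0 vT).
    by rewrite /rough_integral_comp IsE.
  rewrite /incr (Is0 t)// (Is0 s)// (add_f 0 s t)// (addIs 0 s t)//.
  rewrite !opprD !addrA; rewrite [LHS](ACl (3*5*(1*6)*(2*7)*(4*8)))/=.
  by rewrite !subrr !addr0.
(* [J] is additive, so it is the integral of F(X) against the lift of X as
   soon as it has the right local expansion up to o(t - s). *)
pose J s t := mxint (fun r => F (X r) *m f (X r)) s t + Ifs s t.
have addJ : additive_on T J.
  move=> s u t s0 su ut tT; rewrite /J (add_Ff s u t)// (addIfs s u t)//.
  by rewrite addrACA.
have OJ : is_O T (3 * alpha) (fun s t => J s t -
    rough_germ X XX (comp_path (fun x => cols (F x)) X)
      (comp_deriv (fun x => cols (F x)) X (fun=> 1%:M)) s t).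
  apply: is_O_mx => i j; rewrite (ord1 j) {j}.
  set GX := rough_germ X XX _ _.
  apply: (@eq_is_O _ _ _ _ (fun s t => J s t i 0 - GX s t i 0)).
    by move=> s t _ _ _; rewrite (mx_subE (J s t) (GX s t)).
  pose DF a k s := 'D_(delta_mx a 0) (fun x => F x i k) (X s).
  set Gs := (G in is_O _ _ (fun s t => Is s t - G s t)) in OIs.
  set Ge := (G in is_O _ _ (fun s t => Ie s t - G s t)) in OIe.
  set Gfs := (G in is_O _ _ (fun s t => Ifs s t - G s t)) in OIfs.
  (* The two drift errors: [LF] from freezing F(X_r) at time s in the integral of F(X) f(X), and
     [LX] the drift part of the lift. *)
  pose LF k s t := Rintegral (@lebesgue_measure R) `[s, t]
    (fun r => (F (X r) i k - F (X s) i k) * f (X r) k 0).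
  pose LX a k s t := Rintegral (@lebesgue_measure R) `[s, t]
    (fun r => (X r a 0 - X s a 0) * f (X r) k 0).
  have bDF a k : bounded_path T (DF a k).
    have [_ DFc] := C_F i k.
    exact: bounded_path_comp bX _ (@CkS_Ck _ _ _ 0 _ (DFc _)).
  have bF k : bounded_path T (fun s => F (X s) i k) by exact: bounded_path_comp bX _ (cF i k).
  have bf k : bounded_path T (fun s => f (X s) k 0) by exact: bounded_path_comp bX _ (cf k).
  have bXa a : bounded_path T (fun s => X s a 0).
    exact: bounded_path_comp bX _ (@coord_continuous R d 1 a 0).
  have OLF k : is_O T (3 * alpha) (LF k).
    (* The comparison of exponents is 2 * alpha <= 1, from alpha < H <= 1/2. *)
    apply: (@is_O_le _ _ _ (1 + alpha)) => //; first lra.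
    apply: (is_O_Rintegral_incr (g := fun r => F (X r) i k)) => //.
    - exact: is_O_incr_comp bX OX _ (CkS_Ck (C_F i k)).
  have OLX a k : is_O T (3 * alpha) (LX a k).
    apply: (@is_O_le _ _ _ (1 + alpha)) => //; first lra.
    apply: (is_O_Rintegral_incr (g := fun r => X r a 0)) => //.
    - exact: is_O_incr_comp bX OX _ (Ck_coord 1 a).
  have Ors k : is_O T (3 * alpha) (fun s t => Is s t k 0 - Gs s t k 0).
    by apply: eq_is_O (is_O_entry k 0 OIs) => s t _ _ _; rewrite (mx_subE (Is s t)).
  have Ore a k : is_O T (3 * alpha) (fun s t => Ie s t a k - Ge s t a k).
    by apply: eq_is_O (is_O_entry a k OIe) => s t _ _ _; rewrite (mx_subE (Ie s t)).
  have Orfs : is_O T (3 * alpha) (fun s t => Ifs s t i 0 - Gfs s t i 0).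
    by apply: eq_is_O (is_O_entry i 0 OIfs) => s t _ _ _; rewrite (mx_subE (Ifs s t)).
  (* The error in closed form: the sewing error of (F sigma)(X), the drift error [LF], then the
     errors in the expansions of X and of its lift, weighted by F(X_s) and DF(X_s). Each is a
     bounded factor times a term of order 3 alpha. *)
  apply: (@eq_is_O _ _ _ _ (fun s t => Ifs s t i 0 - Gfs s t i 0 +
    \sum_k LF k s t - \sum_k F (X s) i k * (Is s t k 0 - Gs s t k 0) -
    \sum_a \sum_k DF a k s * (LX a k s t + (Ie s t a k - Ge s t a k) -
      X s a 0 * (Is s t k 0 - Gs s t k 0)))); last first.
    apply: is_OB; last first.
      apply: is_O_sum => a; apply: is_O_sum => k; apply: is_OMl; first exact: bDF.
      apply: is_OB; last exact: (is_OMl (bXa a) (Ors k)).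
      exact: (is_OD (OLX a k) (Ore a k)).
    apply: is_OB; last by apply: is_O_sum => k; exact: (is_OMl (bF k) (Ors k)).
    apply: is_OD; first exact: Orfs.
    exact: (is_O_sum OLF).
  move=> s t s0 st tT; have st' := ltW st.
  pose DS b k l := 'D_(col b (sigma (X s))) (fun x => sigma x k l) (X s).
  pose G k := \sum_l incr W s t l 0 * sigma (X s) k l +
    \sum_b \sum_l WW s t b l * DS b k l.
  pose E a k := \sum_l incr W s t l 0 * (X s a 0 * sigma (X s) k l) +
    \sum_b \sum_l WW s t b l *
      (X s a 0 * DS b k l + sigma (X s) k l * sigma (X s) a b).
  have colsE (M : 'cV[R]_d -> 'M[R]_d) k l :
      (fun x => cols (M x) l k 0) = (fun x => M x k l).
    by apply/funext => x; rewrite mxE.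
  have GsE k : Gs s t k 0 = G k.
    rewrite /Gs rough_germ_entry; last by move=> k' i' j' x; have [] := C_cols_sigma k' i' j'.
    rewrite /G; congr (_ + _); first by apply: eq_bigr => l _; rewrite [cols _ _ _ _]mxE.
    by apply: eq_bigr => b _; apply: eq_bigr => l _; rewrite (colsE sigma).
  have GeE a k : Ge s t a k = E a k.
    rewrite /Ge rough_germ_entry; last by move=> k' i' j' x; have [] := C_eta k' i' j'.
    rewrite /E; congr (_ + _).
      by apply: eq_bigr => l _; have /(congr1 (fun h => h (X s))) := etaE l a k => /= ->.
    apply: eq_bigr => b _; apply: eq_bigr => l _; rewrite etaE; congr (_ * _).
    rewrite deriveM; [|exact/diff_derivable/differentiable_coord|exact/diff_derivable].
    by rewrite derive_coord [col _ _ _ _]mxE.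
  have GfsE : Gfs s t i 0 = \sum_k G k * F (X s) i k +
      \sum_a \sum_k (E a k - X s a 0 * G k) * DF a k s.
    rewrite -rough_germ_identity /Gfs rough_germ_entry; last first.
      by move=> k' i' j' x; have [] := C_Fs k' i' j'.
    congr (_ + _); first by apply: eq_bigr => l _; rewrite [cols _ _ _ _]mxE [(_ *m _) _ _]mxE.
    apply: eq_bigr => b _; apply: eq_bigr => l _; rewrite FsE; congr (_ * _).
    have -> : (fun x => \sum_k F x i k * sigma x k l) =
        \sum_k ((fun x => F x i k) * (fun x => sigma x k l)).
      by apply/funext => x; rewrite fct_sumE.
    rewrite derive_sum => [|k]; last by apply: derivableM; exact: diff_derivable.
    apply: eq_bigr => k _; rewrite deriveM; [|exact: diff_derivable|exact: diff_derivable].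
    rewrite -/(DS b k l); congr (_ + _ *: _); rewrite deriv_sum_coord//.
    by apply: eq_bigr => a _; rewrite [col _ _ _ _]mxE.
  (* X is controlled by itself with the identity as Gubinelli derivative, so the directions are the
     basis vectors and the coefficients are the [DF a k]. *)
  have GXE : GX s t i 0 =
      \sum_k incr X s t k 0 * F (X s) i k +
      \sum_a \sum_k XX s t a k * DF a k s.
    rewrite /GX rough_germ_entry; last by move=> k' i' j' x; have [] := C_cols_F k' i' j'.
    congr (_ + _); first by apply: eq_bigr => l _; rewrite [cols _ _ _ _]mxE.
    apply: eq_bigr => a _; apply: eq_bigr => k _; rewrite (colsE F) /DF.
    have -> : col a 1%:M = delta_mx a 0 :> 'cV[R]_d; last by [].
    by apply/colP => c; rewrite !mxE andbT.
  pose Pf k := mxint (fun r => f (X r)) s t k 0.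
  have incrXE k : incr X s t k 0 = Pf k + Is s t k 0 by rewrite incrX// mxE.
  have XXE a k : XX s t a k = LX a k s t + Ie s t a k - X s a 0 * Is s t k 0.
    rewrite (XX_def _ _ (inT _ s0 (le_trans st' tT)) (inT _ (le_trans s0 st') tT)).
    rewrite /solution_lift /rough_integral_comp IsE// IeE// !mxE.
    rewrite big_ord1 !mxE; congr (_ + _ - _).
    rewrite /mxint /oriented st' mxE; apply: eq_Rintegral => r _.
    by rewrite /tens !mxE big_ord1 !mxE.
  pose Q k := Rintegral (@lebesgue_measure R) `[s, t] (fun r => F (X r) i k * f (X r) k 0).
  have cQ l : {within `[0, T], continuous (fun r => F (X r) i l * f (X r) l 0)}.
    by move=> r; apply: cvgM; [exact: (c_comp _ (cF i l))|exact: (c_comp _ (cf l))].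
  have LFE k : LF k s t = Q k - F (X s) i k * Pf k.
    rewrite /Pf mxintE// -RintegralZl//; last by apply: (integrable_subitv (T := T)).
    rewrite -RintegralB//; last 2 first.
    - by apply: (integrable_subitv (T := T)).
    - apply: (integrable_subitv (T := T)) => // r.
      by apply: cvgM; [exact: cvg_cst|exact: (c_comp _ (cf k))].
    by apply: eq_Rintegral => r _; rewrite mulrBl.
  have FfE : mxint (fun r => F (X r) *m f (X r)) s t i 0 = \sum_k Q k.
    rewrite mxintE// -(@Rintegral_sum _ T)//.
    by apply: eq_Rintegral => r _; rewrite mxE.
  have JE : J s t i 0 = \sum_k Q k + Ifs s t i 0.
    by rewrite -FfE /J; move: (mxint _ s t) => M; rewrite mxE.
  (* Only the identities collected above matter now, and the abbreviations become atoms for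
     [ring]. *)
  clearbody J GX Gfs Gs Ge LF LX Q Pf G E DF.
  rewrite JE GXE GfsE.
  have -> : \sum_k LF k s t = \sum_k Q k - \sum_k F (X s) i k * Pf k.
    by rewrite -sumrB; apply: eq_bigr => k _.
  have -> : \sum_k incr X s t k 0 * F (X s) i k = \sum_k F (X s) i k * Pf k +
      \sum_k F (X s) i k * (Is s t k 0 - Gs s t k 0) + \sum_k G k * F (X s) i k.
    rewrite -!big_split; apply: eq_bigr => k _ /=.
    by rewrite incrXE GsE; ring.
  have -> : \sum_a \sum_k XX s t a k * DF a k s =
      \sum_a \sum_k DF a k s * (LX a k s t + (Ie s t a k - Ge s t a k) -
        X s a 0 * (Is s t k 0 - Gs s t k 0)) +
      \sum_a \sum_k (E a k - X s a 0 * G k) * DF a k s.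
    rewrite -big_split; apply: eq_bigr => a _; rewrite -big_split; apply: eq_bigr => k _ /=.
    by rewrite XXE GeE GsE; ring.
  by ring.
have [int_F IFE] := rough_integral_unique th1 addJ OJ (lexx 0) (ltW T_gt0) (lexx T).
split; [exact: int_F|exact: int_fs|].
by rewrite /rough_integral_comp IFE IfsE.
Qed.
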